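(* Consider a 3-user CGZIC $Y_1=X_1+Z_1$, $Y_2=X_2+a_1X_1+Z_2$, $Y_3=X_3+a_2X_2+Z_3$ with power constraints $P_1,P_2,P_3$, and suppose $1\le a_1<\sqrt{1+P_2}$ and $1\le a_2<\sqrt{1+P_3}$. Then the capacity region is the set of all nonnegative rate triples $(R_1,R_2,R_3)$ satisfying, for $i=1,2,3$ and $j=1,2$, \[ R_i\le \mathcal{C}(P_i),\qquad R_j\le \mathcal{C}(a_j^2P_j),\qquad R_j+R_{j+1}\le \mathcal{C}(a_j^2P_j+P_{j+1}). \]
   Context: The noises $Z_i\sim\mathcal N(0,1)$ are i.i.d. (independent across users and time), the channel is memoryless and real, user $i$ has average power constraint $P_i>0$, each receiver $i$ decodes only its own message $W_i$ from $Y_i^n$, and the capacity region is the closure of the set of achievable rate triples (rates for which the average error probability of every user tends to $0$ as blocklength grows). $\mathcal{C}(x)=\tfrac12\log_2(1+x)$. *)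

(* Defs.v *)
From HB Require Import structures.
From mathcomp Require Import all_boot all_order all_algebra.
From mathcomp Require Import all_classical all_reals all_analysis.
Set Implicit Arguments. Unset Strict Implicit. Unset Printing Implicit Defensive.
Import Order.TTheory GRing.Theory Num.Theory.
Import numFieldTopology.Exports numFieldNormedType.Exports.
Local Open Scope classical_set_scope.
Local Open Scope ring_scope.

Section cgzic.
Variable R : realType.

Definition Cg (x : R) : R := ln (1 + x) / (2 * ln 2).

(** Real signals of blocklength n are represented as sequences
    [nat -> R]; only the coordinates t < n are used. *)
Definition scons (z : R) (s : nat -> R) : nat -> R :=
  fun t => if t is t'.+1 then s t' else z.

Definition borel_n (n : nat) : set (set (nat -> R)) :=
  <<s [set A | exists B : nat -> set R,
          (forall t, measurable (B t)) /\
          A = [set y | forall t, (t < n)%N -> B t (y t)]] >>.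

(** [gauss_int n F] = E[F(Z_0,...,Z_{n-1},0,0,...)] with Z_t i.i.d. N(0,1),
    computed as an iterated Lebesgue integral against the standard normal
    law (equal to the integral against the product measure N(0,1)^n for
    Borel-measurable F). *)
Fixpoint gauss_int (n : nat) (F : (nat -> R) -> \bar R) : \bar R :=
  match n with
  | 0 => F (fun _ => 0)
  | m.+1 => (\int[normal_prob (0:R) 1]_z gauss_int m (fun s => F (scons z s)))%E
  end.

Definition dec_err (n M : nat) (g : (nat -> R) -> 'I_M) (x : nat -> R)
  (w : 'I_M) : \bar R :=
  gauss_int n (fun z => (if g (fun t => x t + z t) != w then 1 else 0)%:E).

Record code (n M1 M2 M3 : nat) := Code {
  enc1 : 'I_M1 -> nat -> R;
  enc2 : 'I_M2 -> nat -> R;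
  enc3 : 'I_M3 -> nat -> R;
  dec1 : (nat -> R) -> 'I_M1;
  dec2 : (nat -> R) -> 'I_M2;
  dec3 : (nat -> R) -> 'I_M3 }.

Definition code_ok (P1 P2 P3 : R) n M1 M2 M3 (c : code n M1 M2 M3) : Prop :=
  [/\ (forall w, \sum_(t < n) (enc1 c w t) ^+ 2 <= n%:R * P1),
      (forall w, \sum_(t < n) (enc2 c w t) ^+ 2 <= n%:R * P2),
      (forall w, \sum_(t < n) (enc3 c w t) ^+ 2 <= n%:R * P3) &
      [/\ forall w, borel_n n [set y | dec1 c y = w],
           forall w, borel_n n [set y | dec2 c y = w] &
           forall w, borel_n n [set y | dec3 c y = w]]].

Definition avg (M1 M2 M3 : nat) (f : 'I_M1 -> 'I_M2 -> 'I_M3 -> \bar R) : \bar R :=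
  ((\sum_(w1 < M1) \sum_(w2 < M2) \sum_(w3 < M3) f w1 w2 w3)
     * ((M1 * M2 * M3)%:R^-1)%:E)%E.

Definition err1 n M1 M2 M3 (c : code n M1 M2 M3) : \bar R :=
  avg (fun (w1 : 'I_M1) (w2 : 'I_M2) (w3 : 'I_M3) => dec_err n (dec1 c) (enc1 c w1) w1).

Definition err2 (a1 : R) n M1 M2 M3 (c : code n M1 M2 M3) : \bar R :=
  avg (fun (w1 : 'I_M1) (w2 : 'I_M2) (w3 : 'I_M3) =>
    dec_err n (dec2 c) (fun t => enc2 c w2 t + a1 * enc1 c w1 t) w2).

Definition err3 (a2 : R) n M1 M2 M3 (c : code n M1 M2 M3) : \bar R :=
  avg (fun (w1 : 'I_M1) (w2 : 'I_M2) (w3 : 'I_M3) =>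
    dec_err n (dec3 c) (fun t => enc3 c w3 t + a2 * enc2 c w2 t) w3).

Definition achievable (a1 a2 P1 P2 P3 : R) (r : R * R * R) : Prop :=
  let: (R1, R2, R3) := r in
  [/\ 0 <= R1, 0 <= R2, 0 <= R3 &
   forall eps : R, 0 < eps -> exists N : nat, forall n : nat, (N <= n)%N ->
     exists (M1 M2 M3 : nat) (c : code n M1 M2 M3),
       [/\ code_ok P1 P2 P3 c,
           2 `^ (n%:R * R1) <= M1%:R,
           2 `^ (n%:R * R2) <= M2%:R,
           2 `^ (n%:R * R3) <= M3%:R &
           [/\ (err1 c <= eps%:E)%E, (err2 a1 c <= eps%:E)%E &
               (err3 a2 c <= eps%:E)%E]]].

Definition capacity_region (a1 a2 P1 P2 P3 : R) : set (R * R * R) :=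
  @closure (R * R * R)%type (achievable a1 a2 P1 P2 P3).

End cgzic.

(* Main.v *)
(** Converse.  For a codeword [x] of power at most [S] compare the law of [x + Z] with the
output law [Q = N(0, 1 + S)^n]: a decoding set of conditional probability close to [1] has
[Q]-measure at least [exp (- n (ln (1 + S) / 2 + o(1)))], up to an exponentially small Chernoff
error, and the decoding sets are disjoint.  Since the average error tends to [0], it suffices that
a fixed fraction of the codewords has power at most [S], so only the average power matters.  For a
sum rate, the receiver with cross gain [a >= 1] first decodes its own message, subtracts the
corresponding codeword, divides by [a] and adds noise so as to reproduce the channel at which the
interfering message is decodable; centering the superposed codewords kills the cross term of their
powers.

Achievability.  Each receiver decodes both users it hears, with i.i.d. Gaussian codebooks of power
[P / (1 + d)] and a test of the residual energy.  All error events are bounded by exponentials of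
quadratic forms, whose means follow from the semigroup identity for Gaussian kernels.  Receiver 1
is the same two-user receiver with a dummy interferer of gain [0]. *)

Require Import Defs.
From HB Require Import structures.
From mathcomp Require Import all_boot all_order all_algebra.
From mathcomp Require Import all_classical all_reals all_analysis.
From mathcomp Require Import measurable_realfun ring lra zify.
Set Implicit Arguments. Unset Strict Implicit. Unset Printing Implicit Defensive.
Import Order.TTheory GRing.Theory Num.Theory.
Import numFieldTopology.Exports numFieldNormedType.Exports.
Local Open Scope classical_set_scope.
Local Open Scope ring_scope.

(** * The standard normal law in one dimension *)

(** Entropy and Fano's inequality are avoided: above the region it is enough to keep the error away
    from zero, and comparison with a single product law leaves only Gaussian integrals that factor
    over the coordinates. For the same reason indicators of error events are replaced by exponential
    majorants instead of typical sets, so no law of large numbers enters.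

    Decoders are deterministic. The extra noise of the degradation step is therefore frozen at one
    good value, and a user outside the pair under study is frozen at one good codeword. In the other
    direction one codebook must serve three receivers, so their error bounds are added before a
    codebook is selected.

    The power constraint binds every codeword, whereas a random codeword obeys it only with high
    probability: codewords that are too strong are replaced by the zero word, and a tail term pays
    for the change.

    Signals are indexed by all of [nat]; the noise vanishes beyond the blocklength but codewords are
    arbitrary there, hence the recurring condition that functions look only at the first [n]
    coordinates. *)

Lemma integral_prob_cst d (T : measurableType d) (R : realType) (P : probability T R) (K : \bar R) :
  (\int[P]_x K = K)%E.
Proof. by rewrite integral_cst// [X in (_ * X)%E]probability_setT mule1. Qed.

Section density.
Local Open Scope ereal_scope.
Context d (T : measurableType d) (R : realType).
Variables (mu nu : {measure set T -> \bar R}) (p : T -> R).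
Hypothesis mp : measurable_fun setT p.
Hypothesis p0 : forall x, (0 <= p x)%R.
Hypothesis nup : forall A, measurable A -> nu A = \int[mu]_(x in A) (p x)%:E.

Import HBNNSimple.

Let mfp (f : T -> \bar R) : measurable_fun setT f ->
  measurable_fun setT (fun x => f x * (p x)%:E).
Proof. by move=> mf; apply: emeasurable_funM => //; exact/measurable_EFinP. Qed.

(** The hypothesis [nup] is the case of indicators; linearity gives simple functions, monotone
    convergence the rest. *)
Lemma ge0_integral_density (f : T -> \bar R) :
  measurable_fun setT f -> (forall x, 0 <= f x) ->
  \int[nu]_x f x = \int[mu]_x (f x * (p x)%:E).
Proof.
move=> mf f0; pose f_ := nnsfun_approx measurableT mf.
transitivity (limn (fun n => \int[nu]_x (f_ n x)%:E)).
  rewrite -monotone_convergence//=.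
  - by apply: eq_integral => ? _; apply/esym/cvg_lim => //; exact: cvg_nnsfun_approx.
  - by move=> n; exact/measurable_EFinP/measurable_funTS.
  - by move=> n ? _; rewrite lee_fin.
  - by move=> ? _ ? ? mn; rewrite lee_fin; exact/lefP/nd_nnsfun_approx.
transitivity (limn (fun n => \int[mu]_x ((f_ n x)%:E * (p x)%:E))); last first.
  rewrite -monotone_convergence//=.
  - apply: eq_integral => x _; apply/cvg_lim => //=.
    by apply: cvgeZr => //; exact: cvg_nnsfun_approx.
  - by move=> n; apply: mfp; exact/measurable_EFinP.
  - by move=> n x _; rewrite mule_ge0// lee_fin.
  - move=> x _ m n mn; rewrite lee_wpmul2r ?lee_fin//; exact/lefP/nd_nnsfun_approx.
apply: congr_lim; apply/funext => n /=; move: (f_ n) => {f_} g.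
under [LHS]eq_integral do rewrite fimfunE -fsumEFin//.
rewrite [LHS]ge0_integral_fsum//; last 2 first.
  - by move=> r; exact/measurable_EFinP/measurableT_comp.
  - by move=> n' x _; rewrite EFinM nnfun_muleindic_ge0.
under [RHS]eq_integral.
  move=> x _; rewrite fimfunE -fsumEFin// ge0_mule_fsuml; last first.
    by move=> r; rewrite EFinM nnfun_muleindic_ge0.
  over.
rewrite [RHS]ge0_integral_fsum//; last 2 first.
  - by move=> r; apply: mfp; apply/measurable_EFinP; exact/measurableT_comp.
  - by move=> n' x _; rewrite mule_ge0 // ; [rewrite EFinM nnfun_muleindic_ge0|rewrite lee_fin].
apply: eq_fsbigr => r _.
have [r0|r0] := leP 0%R r; last first.
  rewrite preimage_nnfun0//.
  by rewrite !integral0_eq// => x _; rewrite indicE in_set0 mulr0 ?mul0e.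
have mA : measurable (g @^-1` [set r]) by exact: measurable_sfunP.
under eq_integral do rewrite EFinM.
rewrite ge0_integralZl//; last exact/measurable_EFinP/measurable_indic.
rewrite integral_indic// setIT nup//.
under [RHS]eq_integral do rewrite EFinM -muleA.
rewrite [RHS]ge0_integralZl//; last 2 first.
- by apply: mfp; exact/measurable_EFinP/measurable_indic.
- by move=> x _; rewrite mule_ge0// lee_fin.
congr (_ * _); rewrite integral_mkcond/=; apply: eq_integral => x _.
by rewrite patchE indicE; case: ifP => _; rewrite ?mul1e ?mul0e.
Qed.

End density.

Section affine.
Context (R : realType).
Local Notation mu := (@lebesgue_measure R).

(** Lebesgue measure is determined by its values on half-open intervals, where the scaling is
    explicit. *)
Lemma lebesgue_measure_affine (c s : R) A : 0 < s -> measurable A ->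
  mu A = (s%:E * mu ((fun x : R => c + s * x)%R @^-1` A))%E.
Proof.
move=> s0 mA.
have mf : measurable_fun [set: measurableTypeR R] (fun x : measurableTypeR R => c + s * x : measurableTypeR R).
  by apply: measurable_funD => //; apply: measurable_funM.
pose nu := pushforward mu (fun x : measurableTypeR R => c + s * x : measurableTypeR R).
pose nu' : {measure set (measurableTypeR R) -> \bar R} :=
  mscale (NngNum (ltW s0)) nu.
suff h X : ocitv X -> mu X = nu' mf X by rewrite (lebesgue_measure_unique h mA).
move=> [[a b]/= _ <-].
rewrite /nu' /mscale/= /nu /pushforward/=.
have -> : (fun x => c + s * x) @^-1` `]a, b]%classic = `](a - c) / s, (b - c) / s]%classic.
  apply/seteqP; split=> x /=; rewrite !in_itv/= ltr_pdivrMr// ler_pdivlMr// ltrBlDl lerBrDl (mulrC x) //.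
rewrite !lebesgue_measure_itv/= !lte_fin ltr_pM2r ?invr_gt0// ltrD2r.
case: ifPn => _; last by rewrite mule0.
by rewrite -!EFinB -EFinM; congr EFin; field; rewrite gt_eqF.
Qed.

Lemma ge0_integral_affine (c s : R) (f : R -> \bar R) : 0 < s ->
  measurable_fun setT f -> (forall x, 0 <= f x)%E ->
  (\int[mu]_x f x = s%:E * \int[mu]_x f (c + s * x)%R)%E.
Proof.
move=> s0 mf f0.
have ma : measurable_fun [set: measurableTypeR R] (fun x : measurableTypeR R => c + s * x : measurableTypeR R).
  by apply: measurable_funD => //; apply: measurable_funM.
rewrite -(@ge0_integral_pushforward _ _ _ _ _ _ ma mu setT)//.
rewrite -(ge0_integral_mscale _ measurableT (NngNum (ltW s0)))//.
by apply: eq_measure_integral => A mA _; rewrite [LHS](lebesgue_measure_affine c s0 mA).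
Qed.

Definition gauss : probability (measurableTypeR R) R := normal_prob 0 1.

Lemma normal_pdf_expR (c s x : R) : s != 0 ->
  normal_pdf c s x = (Num.sqrt (2 * pi))^-1 / `|s| * expR (- (x - c) ^+ 2 / (2 * s ^+ 2)).
Proof.
move=> s0; rewrite normal_pdfE// /normal_peak /normal_fun.
by rewrite -mulrnAr sqrtrM ?sqr_ge0// sqrtr_sqr invfM (mulrC `|s|^-1) -(mulr_natl pi) -(mulr_natl (s ^+ 2)).
Qed.

Lemma integral_gauss_affine (c s : R) (f : R -> \bar R) : 0 < s ->
  measurable_fun setT f -> (forall x, 0 <= f x)%E ->
  (\int[gauss]_z f (c + s * z)%R = \int[mu]_y (f y * (normal_pdf c s y)%:E))%E.
Proof.
move=> s0 mf f0.
have ma : measurable_fun [set: R] (fun x : R => c + s * x).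
  by apply: measurable_funD => //; apply: measurable_funM.
have mfa : measurable_fun [set: R] (fun z : R => f (c + s * z)%R).
  exact: (measurableT_comp mf).
rewrite (@ge0_integral_density _ _ _ mu gauss (normal_pdf 0 1)
  (measurable_normal_pdf 0 1) (normal_pdf_ge0 0 1) (fun A _ => erefl) _ mfa (fun _ => f0 _)).
rewrite [RHS](@ge0_integral_affine c s)//; last 2 first.
- apply: emeasurable_funM => //; apply/measurable_EFinP; exact: measurable_normal_pdf.
- by move=> x; rewrite mule_ge0// lee_fin normal_pdf_ge0.
rewrite -ge0_integralZl//=; last 3 first.
- apply: emeasurable_funM => //.
  apply/measurable_EFinP; apply: (measurableT_comp (measurable_normal_pdf _ _)) => //.
- by move=> x _; rewrite mule_ge0// lee_fin normal_pdf_ge0.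
- by rewrite lee_fin ltW.
apply: eq_integral => z _.
rewrite muleCA -EFinM; congr (_ * _%:E)%E.
rewrite !normal_pdf_expR ?gt_eqF// normr1 (gtr0_norm s0).
rewrite [in RHS](_ : - _ / _ = - (z - 0) ^+ 2 / (2 * 1 ^+ 2)); last by field; rewrite gt_eqF.
set k := (_ (2 * pi))^-1; set e := expR _; by field; rewrite gt_eqF.
Qed.

End affine.

Section gauss_single.
Context (R : realType).
Local Notation mu := (@lebesgue_measure R).
Implicit Types (c s l x y z : R).

(** Completing the square turns the integrand times the normal density into a constant times the
    normal density of mean [c / D] and variance [s ^+ 2 / D], where [D = 1 + 2 * l * s ^+ 2].
    Negative [l] is allowed while [D > 0], which serves upper tails; [s = 0] serves the interferer
    of gain zero. *)
Lemma integral_gauss_expR l c s : 0 <= s -> 0 < 1 + 2 * l * s ^+ 2 ->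
  (\int[gauss R]_z (expR (- l * (c + s * z) ^+ 2))%:E =
   ((Num.sqrt (1 + 2 * l * s ^+ 2))^-1 *
    expR (- (l / (1 + 2 * l * s ^+ 2)) * c ^+ 2))%:E)%E.
Proof.
move=> s0 D0; have [s_gt0|s_le0] := ltP 0 s; last first.
  have -> : s = 0 by apply/le_anti; rewrite s0 s_le0.
  under eq_integral do rewrite mul0r addr0.
  by rewrite integral_prob_cst expr0n/= mulr0 addr0 sqrtr1 invr1 mul1r mulr1.
have mf : measurable_fun [set: R] (fun y => (expR (- l * y ^+ 2))%:E).
  apply/measurable_EFinP; apply: measurableT_comp => //.
  by apply: measurable_funM => //; exact: measurable_funX.
rewrite (@integral_gauss_affine _ c s (fun y => (expR (- l * y ^+ 2))%:E) s_gt0 mf);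
  last by move=> y; rewrite lee_fin expR_ge0.
set D := 1 + _ in D0 *; pose q := Num.sqrt D.
have q0 : 0 < q by rewrite sqrtr_gt0.
have qD : q ^+ 2 = D by rewrite sqr_sqrtr// ltW.
have qs : s / q != 0 by rewrite mulf_neq0 ?invr_eq0 ?gt_eqF.
rewrite -[RHS]mule1 -(integral_normal_pdf (c / D) (s / q)).
rewrite -ge0_integralZl; [|exact: measurableT| | |]; last 3 first.
- by apply/measurable_EFinP; exact: measurable_normal_pdf.
- by move=> y _; rewrite lee_fin normal_pdf_ge0.
- by rewrite lee_fin mulr_ge0 ?expR_ge0// invr_ge0 sqrtr_ge0.
apply: eq_integral => y _; rewrite -!EFinM; congr EFin.
rewrite !normal_pdf_expR ?gt_eqF//; last by rewrite divr_gt0.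
rewrite -/q (gtr0_norm s_gt0) gtr0_norm ?divr_gt0//.
rewrite mulrCA -expRD mulrA [RHS]mulrACA -expRD mulrA.
congr (_ * expR _); first by field; rewrite !gt_eqF// sqrtr_gt0 mulr_gt0 ?pi_gt0.
rewrite exprMn exprVn qD /D; field; rewrite -/D ?gt_eqF//.
Qed.

(** The extra factor is the density of [N(0, s ^+ 2)] relative to [N(x, 1)], evaluated at the point
    [x + z]. *)
Lemma integral_gauss_density s x (f : R -> \bar R) : 0 < s ->
  measurable_fun setT f -> (forall y, 0 <= f y)%E ->
  (\int[gauss R]_z (f (x + z)%R * (s^-1 * expR (z ^+ 2 / 2 - (x + z) ^+ 2 / (2 * s ^+ 2)))%:E) =
   \int[gauss R]_z f (s * z)%R)%E.
Proof.
move=> s0 mf f0.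
pose g y := (f y * (s^-1 * expR ((y - x) ^+ 2 / 2 - y ^+ 2 / (2 * s ^+ 2)))%:E)%E.
have mg : measurable_fun [set: R] g.
  apply: emeasurable_funM => //; apply/measurable_EFinP.
  apply: measurable_funM => //; apply: measurableT_comp => //.
  apply: measurable_funB; apply: measurable_funM => //; apply: measurable_funX => //.
  exact: measurable_funB.
have g0 y : (0 <= g y)%E by rewrite mule_ge0// lee_fin mulr_ge0 ?expR_ge0 ?invr_ge0 ?ltW.
transitivity (\int[gauss R]_z g (x + 1 * z)%R)%E.
  by apply: eq_integral => z _; rewrite /g mul1r (_ : x + z - x = z)//; ring.
rewrite integral_gauss_affine//.
under [RHS]eq_integral do rewrite -[(s * _)%R]add0r.
rewrite integral_gauss_affine//; apply: eq_integral => y _.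
rewrite /g -muleA -EFinM; congr (_ * _%:E)%E.
rewrite !normal_pdf_expR ?gt_eqF// normr1 (gtr0_norm s0) divr1.
have -> : - (y - 0) ^+ 2 / (2 * s ^+ 2) = (y - x) ^+ 2 / 2 - y ^+ 2 / (2 * s ^+ 2) +
    - (y - x) ^+ 2 / (2 * 1 ^+ 2) by field; rewrite gt_eqF.
by rewrite [in RHS]expRD mulrACA (mulrC s^-1).
Qed.

(** Tonelli puts the integral over [z] inside; it is then a Gaussian integral with
    [l = (2 * b ^+ 2)^-1], and [a ^+ 2 + b ^+ 2 = 1] makes the result the standard normal
    density. *)
Lemma integral_gauss_rot (a b : R) (f : R -> \bar R) : 0 < a -> 0 <= b ->
  a ^+ 2 + b ^+ 2 = 1 ->
  measurable_fun setT f -> (forall y, 0 <= f y)%E ->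
  (\int[gauss R]_z \int[gauss R]_z' f (a * z + b * z')%R = \int[gauss R]_z f z)%E.
Proof.
move=> a0 b0 ab mf f0; have [b_gt0|b_le0] := ltP 0 b; last first.
  have b_eq0 : b = 0 by apply/le_anti; rewrite b0 b_le0.
  have -> : a = 1.
    apply/eqP; rewrite -(@eqrXn2 _ 2)// ?ltW// expr1n -ab b_eq0 expr0n addr0//.
  rewrite b_eq0; apply: eq_integral => z _.
  under eq_integral do rewrite mul0r addr0 mul1r.
  by rewrite integral_prob_cst.
under eq_integral do rewrite integral_gauss_affine//.
pose g (p : R * R) : \bar R := (f p.2 * (normal_pdf (a * p.1) b p.2)%:E)%E.
have bn0 : b != 0 by rewrite gt_eqF.
have mg : measurable_fun [set: R * R] g.
  apply: emeasurable_funM; first exact: measurableT_comp.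
  apply/measurable_EFinP.
  apply: (eq_measurable_fun (fun p : R * R => (Num.sqrt (2 * pi))^-1 / `|b| *
      expR (- (p.2 - a * p.1) ^+ 2 / (2 * b ^+ 2)))).
    by move=> p _; rewrite normal_pdf_expR.
  apply: measurable_funM => //; apply: measurableT_comp => //.
  apply: measurable_funM => //; apply: measurableT_comp => //.
  apply: measurable_funX; apply: measurable_funB => //; exact: measurable_funM.
have g0 p : (0 <= g p)%E by rewrite mule_ge0// lee_fin normal_pdf_ge0.
rewrite (@fubini_tonelli _ _ _ _ _ (gauss R) mu g mg g0)/=.
under [RHS]eq_integral do rewrite -[X in f X]mul1r -[(1 * _)%R]add0r.
rewrite [RHS]integral_gauss_affine//; apply: eq_integral => y _.
rewrite /g/= ge0_integralZl//; last 2 first.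
- apply/measurable_EFinP.
  apply: (eq_measurable_fun (fun z : R => (Num.sqrt (2 * pi))^-1 / `|b| *
      expR (- (y - a * z) ^+ 2 / (2 * b ^+ 2)))).
    by move=> p _; rewrite normal_pdf_expR.
  apply: measurable_funM => //; apply: measurableT_comp => //.
  apply: measurable_funM => //; apply: measurableT_comp => //.
  apply: measurable_funX; apply: measurable_funB => //; exact: measurable_funM.
- by move=> z _; rewrite lee_fin normal_pdf_ge0.
congr (_ * _)%E.
under eq_integral.
  move=> z _; rewrite normal_pdf_expR ?gt_eqF// EFinM.
  rewrite (_ : - _ / _ = - (2 * b ^+ 2)^-1 * (- y + a * z) ^+ 2); last by field; rewrite gt_eqF.
  over.
rewrite ge0_integralZl//=; last first.
- apply/measurable_EFinP; apply: measurableT_comp => //.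
  apply: measurable_funM => //; apply: measurable_funX; apply: measurable_funD => //; exact: measurable_funM.
have a2 : a ^+ 2 = 1 - b ^+ 2 by rewrite -ab addrK.
have DE : 1 + 2 * (2 * b ^+ 2)^-1 * a ^+ 2 = b^-1 ^+ 2 by rewrite a2; field.
rewrite [X in (_ * X)%E](@integral_gauss_expR (2 * b ^+ 2)^-1 (- y) a) ?ltW//; last first.
  by rewrite DE exprn_gt0 ?invr_gt0.
rewrite DE sqrtr_sqr -EFinM normal_pdf_expR ?oner_neq0//; congr EFin.
rewrite normr1 !gtr0_norm ?invr_gt0// invrK mulrA divfK//.
by rewrite invr1 mulr1; congr (_ * expR _); field.
Qed.

End gauss_single.

(** * Independent sequences *)

(** An alias to which the sigma-algebra generated by the coordinates can be attached. *)
Definition mseq (T : Type) := nat -> T.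
HB.instance Definition _ (T : pointedType) := Pointed.on (mseq T).

Definition mseq_display : measure_display -> measure_display.
Proof. exact. Qed.

Section mseq_measurable.
Context d (T : measurableType d).

Definition mseq_gen : set (set (mseq T)) :=
  [set A | exists t B, measurable B /\ A = [set s | B (s t)]].

HB.instance Definition _ := @isMeasurable.Build (mseq_display d) (mseq T)
  <<s mseq_gen >> (@sigma_algebra0 _ setT mseq_gen) (@sigma_algebraC _ mseq_gen)
  (@sigma_algebra_bigcup _ setT mseq_gen).
End mseq_measurable.

Section mseq_measurable_fun.
Context d (T : measurableType d).

Lemma measurable_coord t : measurable_fun [set: mseq T] (fun s => s t).
Proof.
move=> _ B mB; rewrite setTI; apply: sub_sigma_algebra; exists t, B; by split.
Qed.

Lemma measurable_mseq d' (T' : measurableType d') (f : T' -> mseq T) :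
  (forall t, measurable_fun [set: T'] (fun x => f x t)) -> measurable_fun [set: T'] f.
Proof.
move=> mf; apply: (@measurability _ _ _ _ _ _ (@mseq_gen _ T)) => //.
move=> _ [_ [t [B [mB ->]]] <-].
by rewrite [X in measurable X](_ : _ = setT `&` (fun x => f x t) @^-1` B)//; exact: mf.
Qed.

Definition mcons (z : T) (s : mseq T) : mseq T :=
  fun t => if t is t'.+1 then s t' else z.

Definition upd (s : mseq T) (i : nat) (v : T) : mseq T :=
  fun t => if t == i then v else s t.

Lemma measurable_mcons d' (T' : measurableType d') (f : T' -> T) (g : T' -> mseq T) :
  measurable_fun [set: T'] f -> measurable_fun [set: T'] g ->
  measurable_fun [set: T'] (fun x => mcons (f x) (g x)).
Proof.
move=> mf mg; apply: measurable_mseq => -[//|t]/=.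
exact: (measurableT_comp (measurable_coord t) mg).
Qed.

Lemma measurable_upd d' (T' : measurableType d') i (f : T' -> T) (g : T' -> mseq T) :
  measurable_fun [set: T'] f -> measurable_fun [set: T'] g ->
  measurable_fun [set: T'] (fun x => upd (g x) i (f x)).
Proof.
move=> mf mg; apply: measurable_mseq => t; rewrite /upd; case: (t == i) => //.
exact: (measurableT_comp (measurable_coord t) mg).
Qed.

Definition mcons_pair (p : T * mseq T) : mseq T := mcons p.1 p.2.

Lemma measurable_mcons_pair : measurable_fun setT mcons_pair.
Proof. exact: measurable_mcons. Qed.

HB.instance Definition _ := isMeasurableFun.Build _ _ _ _ mcons_pair measurable_mcons_pair.

End mseq_measurable_fun.

Section iid.
Local Open Scope ereal_scope.
Context d (T : measurableType d) (R : realType).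
Variables (x0 : T) (P : probability T R).

(** A law on infinite sequences whose coordinates from [n] on are frozen at [x0]; with [x0 = 0] this
    is the padding used by [gauss_int]. *)
Fixpoint iid (n : nat) : probability (mseq T) R :=
  if n is m.+1 then distribution (P \x iid m)%E (@mcons_pair _ T)
  else \d_((fun _ => x0) : mseq T).

Lemma integral_iidS n (F : mseq T -> \bar R) :
  measurable_fun setT F -> (forall s, 0 <= F s) ->
  \int[iid n.+1]_s F s = \int[P]_z \int[iid n]_s F (mcons z s).
Proof.
move=> mF F0; rewrite /= ge0_integral_distribution//=.
rewrite (@fubini_tonelli1 _ _ _ _ _ P (iid n) (F \o @mcons_pair _ T)) => [//||x]; last exact: F0.
by apply: measurableT_comp => //; exact: measurable_mcons_pair.
Qed.

Lemma integral_iid0 (F : mseq T -> \bar R) :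
  measurable_fun setT F -> \int[iid 0]_s F s = F (fun _ => x0).
Proof. by move=> mF; rewrite integral_dirac// diracT mul1e. Qed.

(** Independence in the form needed for random coding: entry [i] may be averaged over a fresh copy
    while all other entries stay fixed. *)
Lemma integral_resample n i (F : mseq T -> \bar R) : (i < n)%N ->
  measurable_fun setT F -> (forall s, 0 <= F s) ->
  \int[iid n]_s F s = \int[iid n]_s \int[P]_v F (upd s i v).
Proof.
have mU (G : mseq T -> \bar R) i' : measurable_fun setT G -> (forall s, 0 <= G s) ->
    measurable_fun setT (fun s => \int[P]_v G (upd s i' v)).
  move=> mG G0; apply: (@measurable_fun_fubini_tonelli_F _ _ _ _ _ P
    (fun p : mseq T * T => G (upd p.1 i' p.2))) => //.
  by apply: (measurableT_comp mG); exact: measurable_upd.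
elim: n i F => // n IHn i F ilt mF F0.
have mFc z : measurable_fun setT (fun s => F (mcons z s)).
  exact: (measurableT_comp mF (measurable_mcons (measurable_cst z) (@measurable_id _ _ setT))).
rewrite [RHS]integral_iidS; [|exact: mU|by move=> s; exact: integral_ge0].
rewrite integral_iidS//; case: i ilt => [_|i ilt].
  have updE z s v : upd (mcons z s) 0 v = mcons v s by apply/funext => -[].
  under [RHS]eq_integral do under eq_integral do under eq_integral do rewrite updE.
  rewrite [RHS]integral_prob_cst.
  rewrite (@fubini_tonelli _ _ _ _ _ P (iid n) (fun p => F (mcons p.1 p.2)))//.
  by apply: (measurableT_comp mF); exact: measurable_mcons.
apply: eq_integral => z _; rewrite (IHn i)//.
apply: eq_integral => s _; apply: eq_integral => v _; congr F.
by apply/funext => -[].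
Qed.

Lemma integral_iid_prod n (f : nat -> T -> R) (k : nat -> R) :
  (forall t, measurable_fun setT (f t)) -> (forall t z, 0 <= f t z)%R ->
  (forall t, \int[P]_z (f t z)%:E = (k t)%:E) ->
  \int[iid n]_s (\prod_(t < n) f t (s t))%:E = (\prod_(t < n) k t)%:E.
Proof.
have mprod n' (f' : nat -> T -> R) : (forall t, measurable_fun setT (f' t)) ->
    measurable_fun setT (fun s : mseq T => (\prod_(t < n') f' t (s t))%:E).
  move=> mf; apply/measurable_EFinP; apply: measurable_prod => i _.
  exact: (measurableT_comp (mf i) (measurable_coord i)).
elim: n f k => [|n IHn] f k mf f0 fk.
  by rewrite integral_iid0 ?big_ord0//; exact: mprod.
have p0 n' (f' : nat -> T -> R) (s : 'I_n' -> T) : (forall t z, 0 <= f' t z)%R ->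
    0 <= (\prod_(t < n') f' t (s t))%:E :> \bar R.
  by move=> f'0; rewrite lee_fin; apply: prodr_ge0 => i _.
rewrite integral_iidS; [|exact: mprod|by move=> s; exact: (p0 n.+1 f (fun t => s t))].
transitivity (\int[P]_z ((f 0%N z)%:E * (\prod_(t < n) k t.+1)%:E)).
  apply: eq_integral => z _.
  rewrite -(IHn (fun t => f t.+1) (fun t => k t.+1))// -ge0_integralZl//.
  - by apply: eq_integral => s _; rewrite big_ord_recl EFinM.
  - exact: (mprod n (fun t => f t.+1)).
  - by move=> s _; apply: (p0 n (fun t => f t.+1) (fun t : 'I_n => s t)) => t; exact: f0.
  - by rewrite lee_fin.
rewrite ge0_integralZr//; last 3 first.
- exact/measurable_EFinP.
- by move=> z _; rewrite lee_fin.
- rewrite lee_fin; apply: prodr_ge0 => i _; rewrite -lee_fin -fk.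
  by apply: integral_ge0 => z _; rewrite lee_fin.
by rewrite fk -EFinM big_ord_recl.
Qed.

End iid.

Lemma exists_lt_integral d (T : measurableType d) (R : realType) (P : probability T R)
  (F : T -> \bar R) (K : R) : measurable_fun setT F -> (forall s, 0 <= F s)%E ->
  (0 <= K) -> (\int[P]_s F s < K%:E)%E -> exists s, (F s < K%:E)%E.
Proof.
move=> mF F0 K0 FK; apply: contrapT => /forallNP FN.
have : (\int[P]_s (cst K%:E) s <= \int[P]_s F s)%E.
  apply: ge0_le_integral => //.
  by move=> s _; rewrite leNgt; apply/negP; exact: FN.
by rewrite integral_prob_cst leNgt FK.
Qed.

(** * Standard Gaussian noise vectors *)

Definition giid (R : realType) n : probability (mseq (measurableTypeR R)) R :=
  iid (0 : measurableTypeR R) (gauss R) n.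

Lemma gauss_intE (R : realType) n (F : mseq (measurableTypeR R) -> \bar R) :
  measurable_fun setT F -> (forall s, 0 <= F s)%E ->
  gauss_int n F = (\int[giid R n]_s F s)%E.
Proof.
elim: n F => [|n IHn] F mF F0; first by rewrite [RHS]integral_iid0.
rewrite [RHS]integral_iidS//; apply: eq_integral => z _.
apply: IHn => //; 
exact: (measurableT_comp mF (measurable_mcons (measurable_cst z) (@measurable_id _ _ setT))).
Qed.

Section giid.
Context (R : realType).
Local Notation RS := (mseq (measurableTypeR R)).

Definition energy n (v : nat -> R) : R := \sum_(t < n) v t ^+ 2.

Lemma energy_ge0 n v : 0 <= energy n v.
Proof. by apply: sumr_ge0 => t _; exact: sqr_ge0. Qed.

(** Needed because a codeword may take any values beyond position [n], so a translated noise
    sequence and a scaled one differ there. *)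
Definition nlocal U n (F : (nat -> R) -> U) :=
  forall y y', (forall t, (t < n)%N -> y t = y' t) -> F y = F y'.

Lemma measurable_affine_seq d (T : measurableType d) (f g : T -> RS) (a b : R) :
  measurable_fun setT f -> measurable_fun setT g ->
  measurable_fun setT (fun x => (fun t => a * f x t + b * g x t) : RS).
Proof.
move=> mf mg; apply: measurable_mseq => t.
apply: measurable_funD; apply: measurable_funM => //.
  exact: (measurableT_comp (measurable_coord t) mf).
exact: (measurableT_comp (measurable_coord t) mg).
Qed.

Lemma measurable_addseq d (T : measurableType d) (f g : T -> RS) :
  measurable_fun setT f -> measurable_fun setT g ->
  measurable_fun setT (fun x => (fun t => f x t + g x t) : RS).
Proof.
move=> mf mg; apply: measurable_mseq => t; apply: measurable_funD.
  exact: (measurableT_comp (measurable_coord t) mf).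
exact: (measurableT_comp (measurable_coord t) mg).
Qed.

Lemma measurable_mulseq d (T : measurableType d) (f : T -> RS) (a : R) :
  measurable_fun setT f -> measurable_fun setT (fun x => (fun t => a * f x t) : RS).
Proof.
move=> mf; apply: measurable_mseq => t; apply: measurable_funM => //.
exact: (measurableT_comp (measurable_coord t) mf).
Qed.

Lemma measurable_energy d (T : measurableType d) n (f : T -> RS) :
  measurable_fun setT f -> measurable_fun setT (fun x => energy n (f x)).
Proof.
move=> mf; apply: measurable_sum => t; apply: measurable_funX.
exact: (measurableT_comp (measurable_coord t) mf).
Qed.

Lemma integral_giid_expR n (l s : R) (c : nat -> R) : 0 <= s -> 0 < 1 + 2 * l * s ^+ 2 ->
  (\int[giid R n]_z (expR (- l * energy n (fun t => c t + s * z t)%R))%:E =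
   ((Num.sqrt (1 + 2 * l * s ^+ 2))^-1 ^+ n *
    expR (- (l / (1 + 2 * l * s ^+ 2)) * energy n c))%:E)%E.
Proof.
move=> s0 D0.
have mf t : measurable_fun [set: measurableTypeR R] (fun z : measurableTypeR R => expR (- l * (c t + s * z) ^+ 2)).
  apply: measurableT_comp => //; apply: measurable_funM => //.
  by apply: measurable_funX; apply: measurable_funD => //; exact: measurable_funM.
have := @integral_iid_prod _ _ R (0 : measurableTypeR R) (gauss R) n _ _ mf (fun _ _ => expR_ge0 _)
  (fun t => integral_gauss_expR (c t) s0 D0).
rewrite big_split/= prodr_const card_ord -expR_sum -mulr_sumr => <-.
by apply: eq_integral => z _; rewrite -expR_sum mulr_sumr.
Qed.

Let ratio s (x z : R) := s^-1 * expR (z ^+ 2 / 2 - (x + z) ^+ 2 / (2 * s ^+ 2)).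

Let mratio s x : measurable_fun setT (ratio s x).
Proof.
apply: measurable_funM => //; apply: measurableT_comp => //.
apply: measurable_funB; apply: measurable_funM => //; apply: measurable_funX => //.
exact: measurable_funD.
Qed.

Let ratio_ge0 s x z : 0 < s -> 0 <= ratio s x z.
Proof. by move=> s0; rewrite mulr_ge0 ?expR_ge0// invr_ge0 ltW. Qed.

Let mprod_ratio n s (x : nat -> R) :
  measurable_fun setT (fun z : RS => (\prod_(t < n) ratio s (x t) (z t))%:E).
Proof.
apply/measurable_EFinP; apply: measurable_prod => t _.
exact: (measurableT_comp (mratio s (x t)) (measurable_coord t)).
Qed.

Let madd (x : nat -> R) : measurable_fun [set: RS] (fun z => (fun t => x t + z t) : RS).
Proof. exact: (measurable_addseq (measurable_cst (x : RS)) (@measurable_id _ _ setT)). Qed.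

Let mmul (s : R) : measurable_fun [set: RS] (fun z => (fun t => s * z t) : RS).
Proof. exact: (measurable_mulseq _ (@measurable_id _ _ setT)). Qed.

Let mconsl (v : R) : measurable_fun [set: RS] (mcons (v : measurableTypeR R)).
Proof. exact: (measurable_mcons (measurable_cst _) (@measurable_id _ _ setT)). Qed.

Lemma integral_giid_density n s (x : nat -> R) (F : RS -> \bar R) : 0 < s ->
  measurable_fun setT F -> (forall y, 0 <= F y)%E -> nlocal n F ->
  (\int[giid R n]_z (F (fun t => x t + z t)%R *
     (\prod_(t < n) (s^-1 * expR ((z t) ^+ 2 / 2 - (x t + z t) ^+ 2 / (2 * s ^+ 2))))%:E) =
   \int[giid R n]_z F (fun t => s * z t)%R)%E.
Proof.
move=> s0; elim: n x F => [|n IHn] x F mF F0 nF.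
  (* With no coordinate left, [F] is taken at [x] on one side and at the zero sequence on the other;
     only locality identifies the two values. *)
  rewrite !integral_iid0.
  - by rewrite big_ord0 mule1; exact: nF.
  - exact: (measurableT_comp mF (mmul s)).
  - apply: emeasurable_funM; first exact: (measurableT_comp mF (madd x)).
    exact: mprod_ratio.
pose r := ratio s (x 0); pose x' t := x t.+1.
pose H (v : R) : \bar R := (\int[giid R n]_z F (mcons (v : measurableTypeR R) (fun t => s * z t)%R))%E.
have mH : measurable_fun [set: R] H.
  apply: (@measurable_fun_fubini_tonelli_F _ _ _ _ _ (giid R n)
    (fun p : measurableTypeR R * RS => F (mcons p.1 (fun t => s * p.2 t)))) => //.
  apply: (measurableT_comp mF); apply: measurable_mcons => //; exact: measurable_mulseq.
have H0 v : (0 <= H v)%E by exact: integral_ge0.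
rewrite integral_iidS; last 2 first.
- apply: emeasurable_funM; first exact: (measurableT_comp mF (madd x)).
  exact: mprod_ratio.
- by move=> z; rewrite mule_ge0// lee_fin prodr_ge0// => t _; exact: ratio_ge0.
rewrite integral_iidS; [|exact: (measurableT_comp mF (mmul s))|by []].
transitivity (\int[gauss R]_z (H (x 0 + z)%R * (r z)%:E))%E; last first.
  rewrite (@integral_gauss_density R s (x 0) H s0 mH H0).
  apply: eq_integral => z _; apply: eq_integral => z' _; congr F.
  by apply/funext => -[].
apply: eq_integral => z _.
pose F' := F \o mcons (x 0 + z : measurableTypeR R).
have mF' : measurable_fun setT F' by exact: (measurableT_comp mF (mconsl _)).
have nF' : nlocal n F'.
  by move=> y y' yy'; apply: nF => -[|t]//= tn; exact: yy'.
rewrite /H -(IHn x' F' mF' (fun _ => F0 _) nF').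
rewrite -ge0_integralZr; [|exact: measurableT| | |]; last 3 first.
- apply: emeasurable_funM; first exact: (measurableT_comp mF' (madd x')).
  exact: mprod_ratio.
- by move=> z' _; rewrite mule_ge0 ?F0// lee_fin prodr_ge0// => t _; exact: ratio_ge0.
- by rewrite lee_fin ratio_ge0.
apply: eq_integral => z' _; rewrite -muleA -EFinM big_ord_recl/= [in RHS]mulrC.
by congr (F _ * _)%E; apply/funext => -[].
Qed.

Lemma integral_giid_rot n (a b : R) (F : RS -> \bar R) : 0 < a -> 0 <= b ->
  a ^+ 2 + b ^+ 2 = 1 ->
  measurable_fun setT F -> (forall y, 0 <= F y)%E ->
  (\int[giid R n]_z \int[giid R n]_z' F (fun t => a * z t + b * z' t)%R =
   \int[giid R n]_z F z)%E.
Proof.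
move=> a0 b0 ab; elim: n F => [|n IHn] F mF F0.
  have mF1 z : measurable_fun setT (fun z' : RS => F (fun t => a * z t + b * z' t)).
    exact: (measurableT_comp mF (measurable_affine_seq _ _ (measurable_cst (z : RS)) (@measurable_id _ _ setT))).
  have mF2 : measurable_fun setT (fun z : RS => \int[giid R 0]_z' F (fun t => a * z t + b * z' t)%R)%E.
    apply: (@measurable_fun_fubini_tonelli_F _ _ _ _ _ (giid R 0)
      (fun p : RS * RS => F (fun t => a * p.1 t + b * p.2 t))) => //.
    by apply: (measurableT_comp mF); apply: measurable_affine_seq.
  rewrite !integral_iid0//; congr F; apply/funext => t; by rewrite !mulr0 addr0.
pose H (v : R) : \bar R := (\int[giid R n]_s F (mcons (v : measurableTypeR R) s))%E.
have mH : measurable_fun [set: R] H.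
  apply: (@measurable_fun_fubini_tonelli_F _ _ _ _ _ (giid R n)
    (fun p : measurableTypeR R * RS => F (mcons p.1 p.2))) => //.
  by apply: (measurableT_comp mF); exact: measurable_mcons.
have H0 v : (0 <= H v)%E by exact: integral_ge0.
have mF1 z : measurable_fun setT (fun z' : RS => F (fun t => a * z t + b * z' t)).
  exact: (measurableT_comp mF (measurable_affine_seq _ _ (measurable_cst (z : RS)) (@measurable_id _ _ setT))).
have mF2 : measurable_fun setT (fun z : RS => \int[giid R n.+1]_z' F (fun t => a * z t + b * z' t)%R)%E.
  apply: (@measurable_fun_fubini_tonelli_F _ _ _ _ _ (giid R n.+1)
    (fun p : RS * RS => F (fun t => a * p.1 t + b * p.2 t))) => //.
  by apply: (measurableT_comp mF); apply: measurable_affine_seq.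
rewrite [LHS]integral_iidS//; last by move=> s; exact: integral_ge0.
transitivity (\int[gauss R]_z H z)%E; last exact/esym/integral_iidS.
rewrite -(@integral_gauss_rot R a b H a0 b0 ab mH H0).
apply: eq_integral => z _.
under eq_integral do rewrite integral_iidS//.
(* The tail of the first sequence is exchanged with the head of the second, so that both heads stand
   outside and both tails inside; the one-dimensional rotation and the induction hypothesis then
   apply separately. *)
rewrite (@fubini_tonelli _ _ _ _ _ (giid R n) (gauss R)
  (fun p : RS * measurableTypeR R => \int[giid R n]_s
     F (fun t => a * mcons (z : measurableTypeR R) p.1 t + b * mcons p.2 s t)%R)%E); last 2 first.
- apply: (@measurable_fun_fubini_tonelli_F _ _ _ _ _ (giid R n)
   (fun q : (RS * measurableTypeR R) * RS =>
     F (fun t => a * mcons (z : measurableTypeR R) q.1.1 t + b * mcons q.1.2 q.2 t))) => //.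
  apply: (measurableT_comp mF); apply: measurable_affine_seq.
    apply: measurable_mcons; first exact: measurable_cst.
    exact: measurableT_comp.
  by apply: measurable_mcons => //; exact: measurableT_comp.
- by move=> p; exact: integral_ge0.
apply: eq_integral => z' _ /=.
rewrite /H -(IHn (F \o mcons (a * z + b * z' : measurableTypeR R))
  (measurableT_comp mF (mconsl _)) (fun _ => F0 _)).
apply: eq_integral => s _; apply: eq_integral => s' _; congr F.
by apply/funext => -[].
Qed.
End giid.

(** * Strong converse for a fixed input power *)

(** This is [1 + x <= expR x] at [x = D^-1 - 1]. It turns the normalising constants of Gaussian
    integrals into exponentials, so that Chernoff bounds become comparisons of exponents. *)
Lemma inv_sqrt_le_expR (R : realType) (D : R) : 0 < D ->
  (Num.sqrt D)^-1 <= expR ((D^-1 - 1) / 2).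
Proof.
move=> D0; rewrite -ler_sqr ?nnegrE ?invr_ge0 ?sqrtr_ge0 ?expR_ge0//.
rewrite exprVn sqr_sqrtr ?(ltW D0)// -expRM_natl mulrC divfK//.
have := expR_ge1Dx (D^-1 - 1); lra.
Qed.

Lemma expR_small (R : realType) (c e : R) : 0 < c -> 0 < e ->
  exists N : nat, forall n, (N <= n)%N -> expR (- (n%:R * c)) <= e.
Proof.
move=> c0 e0; exists (Num.bound (e^-1 / c)) => n Nn.
have : e^-1 / c < n%:R.
  apply: lt_le_trans (archi_boundP _) _; first by rewrite divr_ge0 ?invr_ge0 ?ltW.
  by rewrite ler_nat.
rewrite ltr_pdivrMr// => h; rewrite expRN -[e]invrK lef_pV2 ?posrE ?expR_gt0 ?invr_gt0//.
by apply: le_trans (expR_ge1Dx _); lra.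
Qed.

Section decoding.
Context (R : realType).
Local Notation RS := (mseq (measurableTypeR R)).
Variable (J : eqType).
Implicit Types (g : RS -> J) (j : J).

Lemma measurable_fiber d (T : measurableType d) (h : T -> J) j :
  measurable [set y | h y = j] ->
  measurable_fun setT (fun y => ((h y == j)%:R : R)%:E).
Proof.
move=> mA; apply/measurable_EFinP.
apply: (eq_measurable_fun (\1_[set y | h y = j] : T -> R)).
  move=> y _; rewrite indicE (_ : (y \in _) = (h y == j))//.
  by apply/idP/eqP; rewrite inE.
exact: measurable_indic.
Qed.

Lemma measurable_fiberN d (T : measurableType d) (h : T -> J) j :
  measurable [set y | h y = j] ->
  measurable_fun setT (fun y => ((h y != j)%:R : R)%:E).
Proof.
move=> mA; apply/measurable_EFinP.
apply: (eq_measurable_fun (\1_(~` [set y | h y = j]) : T -> R)).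
  move=> y _; rewrite indicE (_ : (y \in _) = (h y != j))//.
  by apply/idP/idP => [|/eqP ?]; rewrite inE// => ?; exact/eqP.
by apply: measurable_indic; exact: measurableC.
Qed.

(* Let i be the information density of x + z against the output law N(0, 1 + S)^n.  Then exp (- i)
   is the density ratio of [integral_giid_density], and a change of measure is combined with the
   Chernoff bound on i through 1 <= exp (a - i) + exp (l (i - a)). *)
Lemma word_converse n (g : RS -> J) j (x : nat -> R) (S l : R) :
  0 < S -> 0 < l -> measurable [set y | g y = j] -> nlocal n g ->
  energy n x <= n%:R * S ->
  (1 <= \int[giid R n]_z ((g (fun t => x t + z t)%R != j)%:R : R)%:E +
    (expR (n%:R * (ln (1 + S) / 2 + l)))%:E *
      \int[giid R n]_z ((g (fun t => expR (ln (1 + S) / 2) * z t)%R == j)%:R : R)%:E +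
    (expR (- (n%:R * (l ^+ 2 / 2))))%:E)%E.
Proof.
move=> S0 l0 mg ng xS.
set s := expR (ln (1 + S) / 2).
have s0 : 0 < s by exact: expR_gt0.
have s2 : s ^+ 2 = 1 + S.
  by rewrite -expRM_natl mulrC divfK// lnK// posrE addr_gt0.
set gam := ln (1 + S) / 2 + l.
pose W := 1 + S + l * S.
have W0 : 0 < W by rewrite /W !addr_gt0// mulr_gt0.
have lS0 : 0 < l * S by rewrite mulr_gt0.
pose L := l * S / (2 * (1 + S)).
have DE : 1 + 2 * L * 1 ^+ 2 = W / (1 + S) by rewrite /L /W; field; lra.
have D0 : 0 < 1 + 2 * L * 1 ^+ 2 by rewrite DE divr_gt0// addr_gt0.
pose ratio (z : RS) := \prod_(t < n) (s^-1 * expR ((z t) ^+ 2 / 2 - (x t + z t) ^+ 2 / (2 * s ^+ 2))).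
(* Completing the square: [i] is a constant minus a multiple of the energy of the noise recentred at
   [x / S]. Its exponential moment of order [l] is then a Gaussian integral with coefficient [L]. *)
pose i (z : RS) := n%:R * (ln (1 + S) / 2) + energy n x / (2 * S)
  - S / (2 * (1 + S)) * energy n (fun t => - x t / S + 1 * z t).
have ratioE z : ratio z = expR (- i z).
  have e : \sum_(t < n) (z t ^+ 2 / 2 - (x t + z t) ^+ 2 / (2 * s ^+ 2)) =
      S / (2 * (1 + S)) * energy n (fun t => - x t / S + 1 * z t) - energy n x / (2 * S).
    rewrite /energy mulr_suml mulr_sumr -sumrB; apply: eq_bigr => t _; rewrite s2.
    by field; lra.
  rewrite /ratio {1}/s -expRN big_split/= prodr_const card_ord -expRM_natl -expR_sum -expRD e /i.
  by congr expR; lra.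
have key z : 1 <= (g (fun t => x t + z t) != j)%:R +
    expR (n%:R * gam) * ((g (fun t => x t + z t) == j)%:R * ratio z) +
    expR (l * (i z - n%:R * gam)).
  have E0 := expR_ge0 (l * (i z - n%:R * gam)).
  case: (g _ == j) => /=; last by rewrite mul0r mulr0; lra.
  rewrite mul1r add0r ratioE -expRD.
  have [h|h] := leP (i z) (n%:R * gam).
    have := expR_ge1Dx (n%:R * gam - i z); lra.
  have : 0 <= l * (i z - n%:R * gam) by rewrite mulr_ge0 ?ltW ?subr_gt0.
  have := expR_ge1Dx (l * (i z - n%:R * gam)); have := expR_ge0 (n%:R * gam - i z); lra.
have madd : measurable_fun [set: RS] (fun z => (fun t => x t + z t) : RS).
  exact: (measurable_addseq (measurable_cst (x : RS)) (@measurable_id _ _ setT)).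
have mratio : measurable_fun [set: RS] (fun z => (ratio z)%:E).
  apply/measurable_EFinP; apply: measurable_prod => t _; apply: measurable_funM => //.
  apply: measurableT_comp => //; apply: measurable_funB; apply: measurable_funM => //;
    apply: measurable_funX => //; last apply: measurable_funD => //;
    exact: (measurable_coord t).
have m1 : measurable_fun [set: RS] (fun z => ((g (fun t => x t + z t) != j)%:R : R)%:E).
  exact: (measurableT_comp (measurable_fiberN mg) madd).
have m2 : measurable_fun [set: RS] (fun z => ((g (fun t => x t + z t) == j)%:R : R)%:E).
  exact: (measurableT_comp (measurable_fiber mg) madd).
have mE : measurable_fun [set: RS] (fun z => (expR (- L * energy n (fun t => - x t / S + 1 * z t)))%:E).
  apply/measurable_EFinP; apply: measurableT_comp => //; apply: measurable_funM => //.
  apply: measurable_energy.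
  apply: (measurable_addseq (measurable_cst ((fun t => - x t / S) : RS))).
  exact: (measurable_mulseq 1 (@measurable_id _ _ setT)).
pose A := (\int[giid R n]_z ((g (fun t => x t + z t)%R != j)%:R : R)%:E)%E.
pose Q := (\int[giid R n]_z ((g (fun t => s * z t)%R == j)%:R : R)%:E)%E.
have QE : Q = (\int[giid R n]_z (((g (fun t => x t + z t)%R == j)%:R : R)%:E * (ratio z)%:E))%E.
  rewrite /Q -(@integral_giid_density R n s x (fun y => ((g y == j)%:R : R)%:E) s0)//.
  - exact: measurable_fiber.
  - by move=> y y' yy'; rewrite (ng _ _ yy').
have EE : (\int[giid R n]_z (expR (l * (i z - n%:R * gam)))%:E <= (expR (- (n%:R * (l ^+ 2 / 2))))%:E)%E.
  pose c0 := l * (energy n x / (2 * S)) - n%:R * l ^+ 2.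
  have -> : (\int[giid R n]_z (expR (l * (i z - n%:R * gam)))%:E =
      \int[giid R n]_z ((expR c0)%:E * (expR (- L * energy n (fun t => - x t / S + 1 * z t)%R))%:E))%E.
    apply: eq_integral => z _; rewrite -EFinM -expRD; congr (expR _)%:E.
    by rewrite /c0 /i /gam /L; field; lra.
  rewrite ge0_integralZl; [|exact: measurableT|exact: mE| |by rewrite lee_fin expR_ge0]; last first.
    by move=> z _; rewrite lee_fin expR_ge0.
  rewrite integral_giid_expR// -EFinM lee_fin.
  have -> : energy n (fun t => - x t / S) = energy n x / S ^+ 2.
    by rewrite /energy mulr_suml; apply: eq_bigr => t _; field; lra.
  have sD := inv_sqrt_le_expR D0.
  apply: (@le_trans _ _ (expR c0 * (expR (n%:R * (((1 + 2 * L * 1 ^+ 2)^-1 - 1) / 2)) *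
      expR (- (L / (1 + 2 * L * 1 ^+ 2)) * (energy n x / S ^+ 2))))).
    rewrite ler_pM2l ?expR_gt0// ler_pM2r ?expR_gt0// expRM_natl.
    by apply: lerXn2r => //; rewrite nnegrE ?invr_ge0 ?sqrtr_ge0 ?expR_ge0.
  rewrite -!expRD ler_expR DE /c0 /L.
  (* The exponent increases with the energy of [x], so the worst case is [n * S]. There it equals
     [n * l ^+ 2 * (S / (2 * W) - 1)], which is at most [- n * l ^+ 2 / 2] because [S <= W]. *)
  have -> : l * (energy n x / (2 * S)) - n%:R * l ^+ 2 + (n%:R * (((W / (1 + S))^-1 - 1) / 2) +
     - (l * S / (2 * (1 + S)) / (W / (1 + S))) * (energy n x / S ^+ 2)) =
     l * (1 + l) / (2 * W) * energy n x - n%:R * l * S / (2 * W) - n%:R * l ^+ 2.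
    by rewrite /W; field; rewrite -/W; lra.
  have h1 : l * (1 + l) / (2 * W) * energy n x <= l * (1 + l) / (2 * W) * (n%:R * S).
    by apply: ler_wpM2l => //; rewrite divr_ge0 ?mulr_ge0 ?addr_ge0 ?ltW.
  have h2 : n%:R * l ^+ 2 * (S / W) <= n%:R * l ^+ 2.
    rewrite -[leRHS]mulr1; apply: ler_wpM2l; first by rewrite mulr_ge0 ?sqr_ge0.
    by rewrite ler_pdivrMr// mul1r /W; lra.
  have e1 : l * (1 + l) / (2 * W) * (n%:R * S) = n%:R * l * S / (2 * W) + n%:R * l ^+ 2 * (S / W) / 2.
    by field; lra.
  lra.
pose f1 (z : RS) : \bar R := ((g (fun t => x t + z t)%R != j)%:R : R)%:E.
pose f2 (z : RS) : \bar R := (((g (fun t => x t + z t)%R == j)%:R : R)%:E * (ratio z)%:E)%E.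
pose f3 (z : RS) : \bar R := (expR (l * (i z - n%:R * gam)))%:E.
have mf2 : measurable_fun setT f2 by exact: emeasurable_funM.
have mf3 : measurable_fun setT f3.
  apply/measurable_EFinP; apply: measurableT_comp => //; apply: measurable_funM => //.
  apply: measurable_funB => //; apply: measurable_funB => //; apply: measurable_funM => //.
  apply: measurable_energy.
  apply: (measurable_addseq (measurable_cst ((fun t => - x t / S) : RS))).
  exact: (measurable_mulseq 1 (@measurable_id _ _ setT)).
have f1_ge0 z : (0 <= f1 z)%E by rewrite lee_fin.
have f2_ge0 z : (0 <= f2 z)%E.
  by rewrite mule_ge0// lee_fin// ratioE expR_ge0.
have f3_ge0 z : (0 <= f3 z)%E by rewrite lee_fin expR_ge0.
have mKf2 : measurable_fun setT (fun z => (expR (n%:R * gam))%:E * f2 z)%E.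
  exact: emeasurable_funM.
have Kf2_ge0 z : (0 <= (expR (n%:R * gam))%:E * f2 z)%E by rewrite mule_ge0// lee_fin expR_ge0.
rewrite -/A -/Q QE; apply: (@le_trans _ _ (A + (expR (n%:R * gam))%:E * \int[giid R n]_z f2 z +
    \int[giid R n]_z f3 z)%E); last by rewrite leeD2l.
rewrite -ge0_integralZl; [|exact: measurableT|exact: mf2|by move=> z _|by rewrite lee_fin expR_ge0].
rewrite -ge0_integralD; [|exact: measurableT|by move=> z _; exact: f1_ge0|exact: m1|by move=> z _|exact: mKf2].
have mf12 : measurable_fun setT (fun z => f1 z + (expR (n%:R * gam))%:E * f2 z)%E by exact: emeasurable_funD.
rewrite -ge0_integralD; [|exact: measurableT|by move=> z _; exact: adde_ge0|exact: mf12|by move=> z _|exact: mf3].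
have -> : 1%E = (\int[giid R n]_z cst 1%E z)%E :> \bar R.
  by rewrite integral_prob_cst.
apply: ge0_le_integral => //; first exact: emeasurable_funD.
by move=> z _; rewrite /f1 /f2 /f3 -!EFinM -!EFinD lee_fin; exact: key.
Qed.
End decoding.

(** * Averaging over the messages of a code *)

Section average_converse.
Context (R : realType).
Local Notation RS := (mseq (measurableTypeR R)).

Lemma integral_bool_le1 d (T : measurableType d) (P : probability T R) (b : T -> bool) :
  measurable_fun setT (fun y => ((b y)%:R : R)%:E) ->
  (\int[P]_y ((b y)%:R : R)%:E <= 1)%E.
Proof.
move=> mb; apply: (@le_trans _ _ (\int[P]_y cst 1%E y)%E).
  apply: ge0_le_integral => //.
  by move=> z _; rewrite lee_fin; case: (b z).
by rewrite integral_prob_cst.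
Qed.

Lemma integral_bool_fin d (T : measurableType d) (P : probability T R) (b : T -> bool) :
  measurable_fun setT (fun y => ((b y)%:R : R)%:E) ->
  (\int[P]_y ((b y)%:R : R)%:E \is a fin_num)%E.
Proof.
move=> mb; rewrite ge0_fin_numE; last by apply: integral_ge0 => z _; rewrite lee_fin.
by apply: le_lt_trans (integral_bool_le1 P mb) _; rewrite ltry.
Qed.

Definition perr (J : eqType) n (g : RS -> J) (x : nat -> R) (j : J) : R :=
  fine (\int[giid R n]_z ((g (fun t => x t + z t)%R != j)%:R : R)%:E).

Lemma average_converse n (J : finType) (g : RS -> J) (x : J -> nat -> R) (S S' l : R) :
  (0 < n)%N -> 0 < S -> S < S' -> 0 < l ->
  (forall j, measurable [set y | g y = j]) -> nlocal n g ->
  \sum_j energy n (x j) <= #|J|%:R * (n%:R * S) ->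
  #|J|%:R * (1 - S / S') * (1 - expR (- (n%:R * (l ^+ 2 / 2)))) <=
  \sum_j perr n g (x j) j + expR (n%:R * (ln (1 + S') / 2 + l)).
Proof.
move=> n0 S0 SS' l0 mg ng xS.
have S'0 : 0 < S' by exact: lt_trans SS'.
have nR : 0 < n%:R :> R by rewrite ltr0n.
pose G := [pred j | energy n (x j) <= n%:R * S'].
have madd (v : nat -> R) : measurable_fun [set: RS] (fun z => (fun t => v t + z t) : RS).
  exact: (measurable_addseq (measurable_cst (v : RS)) (@measurable_id _ _ setT)).
have mmul (s : R) : measurable_fun [set: RS] (fun z => (fun t => s * z t) : RS).
  exact: (measurable_mulseq _ (@measurable_id _ _ setT)).
have m1 j : measurable_fun [set: RS] (fun z => ((g (fun t => x j t + z t) != j)%:R : R)%:E).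
  exact: (measurableT_comp (measurable_fiberN (mg j)) (madd _)).
set s := expR (ln (1 + S') / 2).
have m2 j : measurable_fun [set: RS] (fun z => ((g (fun t => s * z t) == j)%:R : R)%:E).
  exact: (measurableT_comp (measurable_fiber (mg j)) (mmul _)).
pose Q j : R := fine (\int[giid R n]_z ((g (fun t => s * z t)%R == j)%:R : R)%:E).
set A := expR (n%:R * (ln (1 + S') / 2 + l)).
set B := expR _.
have word j : j \in G -> 1 <= perr n g (x j) j + A * Q j + B.
  rewrite inE => jG; have := word_converse S'0 l0 (mg j) ng jG.
  rewrite -[X in (X + _ + _)%E]fineK; last exact: integral_bool_fin.
  rewrite -[X in (_ + _ * X + _)%E]fineK; last exact: integral_bool_fin.
  by rewrite -EFinM -!EFinD lee_fin.
have Q0 j : 0 <= Q j by apply: fine_ge0; apply: integral_ge0 => z _; rewrite lee_fin.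
have Q1 : \sum_(j in G) Q j <= 1.
  apply: (@le_trans _ _ (\sum_j Q j)); first by rewrite [leRHS](bigID (mem G))/= lerDl sumr_ge0.
  rewrite -lee_fin -sumEFin.
  under eq_bigr do rewrite fineK ?integral_bool_fin//.
  rewrite -ge0_integral_sum//.
  under eq_integral do rewrite sumEFin.
  (* Exactly one message is decoded from each signal, so the indicators add up to 1 pointwise. *)
  rewrite (eq_integral (cst 1%E)); last first.
    move=> z _; rewrite (bigD1 (g (fun t => s * z t)))//= eqxx big1 ?addr0// => j.
    by rewrite eq_sym => /negbTE ->.
  by rewrite integral_prob_cst.
have perr_ge0 j : 0 <= perr n g (x j) j.
  by apply: fine_ge0; apply: integral_ge0 => z _; rewrite lee_fin.
have B1 : B <= 1 by rewrite -expR0 ler_expR oppr_le0 mulr_ge0 ?ltW// divr_gt0 ?exprn_gt0.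
have sumG : #|G|%:R * (1 - B) <= \sum_j perr n g (x j) j + A.
  apply: (@le_trans _ _ (\sum_(j in G) (perr n g (x j) j + A * Q j))).
    rewrite mulr_natl -sumr_const; apply: ler_sum => j jG.
    by have := word j jG; lra.
  rewrite big_split/=; apply: lerD.
    by rewrite [leRHS](bigID (mem G))/= lerDl sumr_ge0.
  by rewrite -mulr_sumr ler_piMr// expR_ge0.
(* Markov's inequality for the energy of a uniformly chosen codeword: raising the level from [S] to
   [S'] secures the fraction [1 - S / S'] of the messages. *)
have markov : #|J|%:R * (1 - S / S') <= #|G|%:R :> R.
  have cJ : #|J|%:R = #|G|%:R + #|[predC G]|%:R :> R by rewrite -natrD cardC.
  have : #|[predC G]|%:R * (n%:R * S') <= #|J|%:R * (n%:R * S).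
    apply: le_trans xS; rewrite [leRHS](bigID (mem [predC G]))/= mulr_natl -sumr_const.
    rewrite -[leLHS]addr0; apply: lerD; last by apply: sumr_ge0 => j _; exact: energy_ge0.
    by apply: ler_sum => j; rewrite !inE -ltNge => /ltW.
  rewrite !(mulrC n%:R) !mulrA ler_pM2r// => h.
  have : #|[predC G]|%:R <= #|J|%:R * (S / S') by rewrite mulrA ler_pdivlMr.
  by rewrite mulrBr mulr1 cJ; lra.
apply: le_trans sumG; apply: ler_wpM2r => //; lra.
Qed.

Lemma rate_converse (S T : R) : 0 < S -> ln (1 + S) / 2 < T ->
  exists2 e : R, 0 < e & exists N : nat, forall n (J : finType) (g : RS -> J) (x : J -> nat -> R),
    (N <= n)%N -> (forall j, measurable [set y | g y = j]) -> nlocal n g ->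
    \sum_j energy n (x j) <= #|J|%:R * (n%:R * S) ->
    expR (n%:R * T) <= #|J|%:R ->
    #|J|%:R * e < \sum_j perr n g (x j) j.
Proof.
(* The gap is [4 * d]: one [d] pays for [S'] in place of [S], one is the slack [l] in the change of
   measure, and the last two make that term smaller than the number of messages by
   [expR (- n * 2 * d)]. *)
move=> S0 ST; pose d := (T - ln (1 + S) / 2) / 4.
have d0 : 0 < d by rewrite divr_gt0// subr_gt0.
pose S' := S + 2 * d; have SS' : S < S' by rewrite /S'; lra.
have S'0 : 0 < S' by rewrite /S'; lra.
pose k := 1 - S / S'.
have k0 : 0 < k by rewrite /k subr_gt0 ltr_pdivrMr// mul1r.
have [N1 HN1] := @expR_small R (d ^+ 2 / 2) (1 / 2) ltac:(by rewrite divr_gt0// exprn_gt0) ltac:(lra).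
have [N2 HN2] := @expR_small R (2 * d) (k / 8) ltac:(lra) ltac:(lra).
(* The Chernoff term costs at most half of the fraction [k] and the change of measure at most
   [k / 8], which leaves at least [3 * k / 8]. *)
exists (k / 8); first lra.
exists (N1 + N2).+1 => n J g x Nn mg ng xS TJ.
have [Nn1 Nn2 n0] : [/\ (N1 <= n)%N, (N2 <= n)%N & (0 < n)%N] by clear -Nn; split; lia.
have h1 := HN1 n Nn1; have h2 := HN2 n Nn2.
have J0 : 0 < #|J|%:R :> R by apply: lt_le_trans TJ; exact: expR_gt0.
have := average_converse n0 S0 SS' d0 mg ng xS; rewrite -/k.
have lnS : ln (1 + S') / 2 <= ln (1 + S) / 2 + d.
  have -> : 1 + S' = (1 + S) * (1 + 2 * d / (1 + S)) by rewrite /S'; field; lra.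
  rewrite lnM ?posrE; [|lra|by rewrite addr_gt0// divr_gt0//; lra].
  have : ln (1 + 2 * d / (1 + S)) <= 2 * d / (1 + S) by apply: le_ln1Dx; rewrite (lt_trans (ltrN10 _))// divr_gt0//; lra.
  have : 2 * d / (1 + S) <= 2 * d by rewrite ler_pdivrMr; [rewrite ler_pMr; lra|lra].
  lra.
have A8 : expR (n%:R * (ln (1 + S') / 2 + d)) <= #|J|%:R * (k / 8).
  apply: (@le_trans _ _ (expR (n%:R * T) * expR (- (n%:R * (2 * d))))).
    rewrite -expRD ler_expR -mulrN -mulrDr; apply: ler_wpM2l => //.
    have : T = ln (1 + S) / 2 + 4 * d by rewrite /d; lra.
    lra.
  by apply: ler_pM => //; exact: expR_ge0.
have : #|J|%:R * k * (1 / 2) <= #|J|%:R * k * (1 - expR (- (n%:R * (d ^+ 2 / 2)))).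
  by apply: ler_wpM2l; [rewrite mulr_ge0 ?ltW|lra].
have : 0 < #|J|%:R * k by rewrite mulr_gt0.
lra.
Qed.
End average_converse.

(** * Converse for two users decoded at one receiver *)

Section mac_converse.
Context (R : realType).
Local Notation RS := (mseq (measurableTypeR R)).

Definition decoder (J : eqType) n (g : RS -> J) :=
  (forall j, measurable [set y | g y = j]) /\ nlocal n g.

Lemma measurable_affineK (c s : R) (v : nat -> R) :
  measurable_fun [set: RS] (fun y => (fun t => c * v t + s * y t) : RS).
Proof. exact: (measurable_affine_seq c s (measurable_cst (v : RS)) (@measurable_id _ _ setT)). Qed.

Lemma decoder_comp (J : eqType) n (g : RS -> J) (f : RS -> RS) :
  measurable_fun setT f ->
  (forall y y', (forall t, (t < n)%N -> y t = y' t) ->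
    forall t, (t < n)%N -> f y t = f y' t) ->
  decoder n g -> decoder n (g \o f).
Proof.
move=> mf lf [mg ng]; split=> [j|y y' yy'].
  by rewrite -[X in measurable X]setTI; exact: (mf measurableT _ (mg j)).
by apply: ng => t tn; exact: lf.
Qed.

(** For one time instant. Codes with nonzero means would add the product of these means to the power
    of the superposition. Subtracting the means is a translation by a known vector, which a decoder
    can undo, and a variance never exceeds the second moment. *)
Lemma centered_energy (Ma Mb : nat) (alpha : R) (v : 'I_Ma -> R) (u : 'I_Mb -> R) :
  (0 < Ma)%N -> (0 < Mb)%N ->
  \sum_a \sum_b (u b + alpha * v a - ((\sum_b u b) / Mb%:R + alpha * ((\sum_a v a) / Ma%:R))) ^+ 2
  <= Ma%:R * \sum_b (u b) ^+ 2 + Mb%:R * (alpha ^+ 2 * \sum_a (v a) ^+ 2).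
Proof.
have cen M (w : 'I_M -> R) : (0 < M)%N ->
    \sum_i (w i - (\sum_i w i) / M%:R) = 0 /\
    \sum_i (w i - (\sum_i w i) / M%:R) ^+ 2 <= \sum_i (w i) ^+ 2.
  move=> M0; set m := (\sum_i w i) / M%:R.
  have M0' : M%:R != 0 :> R by rewrite pnatr_eq0 -lt0n.
  have Sm : \sum_i w i = M%:R * m by rewrite /m mulrC divfK.
  split; first by rewrite sumrB sumr_const card_ord -[m *+ M]mulr_natl -Sm subrr.
  have -> : \sum_i (w i - m) ^+ 2 = \sum_i (w i) ^+ 2 - 2 * m * (\sum_i w i) + M%:R * m ^+ 2.
    rewrite mulr_sumr -sumrB (_ : M%:R * m ^+ 2 = \sum_(i < M) m ^+ 2).
      rewrite -big_split/=.
      by apply: eq_bigr => i _; ring.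
    by rewrite sumr_const card_ord mulr_natl.
  by rewrite Sm; have := sqr_ge0 m; have : 0 <= M%:R :> R by []; nra.
move=> Ma0 Mb0; have [v0 v2] := cen _ v Ma0; have [u0 u2] := cen _ u Mb0.
set mv := _ / Ma%:R in v0 v2 *; set mu := _ / Mb%:R in u0 u2 *.
have -> : \sum_a \sum_b (u b + alpha * v a - (mu + alpha * mv)) ^+ 2 =
    Ma%:R * \sum_b (u b - mu) ^+ 2 + Mb%:R * (alpha ^+ 2 * \sum_a (v a - mv) ^+ 2).
  transitivity (\sum_a (\sum_b (u b - mu) ^+ 2 + Mb%:R * (alpha ^+ 2 * (v a - mv) ^+ 2))).
    apply: eq_bigr => a _.
    transitivity (\sum_b ((u b - mu) ^+ 2 + alpha ^+ 2 * (v a - mv) ^+ 2 +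
        2 * alpha * (v a - mv) * (u b - mu))); first by apply: eq_bigr => b _; ring.
    rewrite big_split/= -[X in _ + X]mulr_sumr u0 mulr0 addr0 big_split/=.
    by rewrite sumr_const card_ord -[X in _ + X]mulr_natl.
  by rewrite big_split/= sumr_const card_ord -[X in X + _]mulr_natl; congr (_ + _); rewrite !mulr_sumr.
apply: lerD; first exact: ler_wpM2l.
by do 2 apply: ler_wpM2l => //; exact: sqr_ge0.
Qed.


Lemma mberr (J : eqType) n (g : RS -> J) (v : nat -> R) j : decoder n g ->
  measurable_fun [set: RS] (fun z => ((g (fun t => v t + z t) != j)%:R : R)%:E).
Proof.
case=> mg _; apply: (measurableT_comp (measurable_fiberN (mg j))).
exact: (measurable_addseq (measurable_cst (v : RS)) (@measurable_id _ _ setT)).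
Qed.

Lemma perrK (J : eqType) n (g : RS -> J) (v : nat -> R) j : decoder n g ->
  ((perr n g v j)%:E = \int[giid R n]_z ((g (fun t => v t + z t)%R != j)%:R : R)%:E)%E.
Proof. by move=> dg; rewrite fineK//; apply: integral_bool_fin; exact: mberr dg. Qed.

Lemma perr_shift (J : eqType) n (g : RS -> J) (v m : nat -> R) j :
  perr n (g \o (fun y => (fun t => 1 * m t + 1 * y t) : RS)) (fun t => v t - m t) j = perr n g v j.
Proof.
congr fine; apply: eq_integral => z _ /=; congr (((g _) != j)%:R)%:E.
by apply/funext => t; ring.
Qed.

(* After subtracting xb, the noise beta w degrades the observation xa + z / alpha to the unit noise
   level at which ga is reliable; some fixed w does as well as the average. *)
Lemma exists_joint_decoder n (Ma Mb : nat) (alpha e : R) (ga : RS -> 'I_Ma) (gb : RS -> 'I_Mb)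
  (xa : 'I_Ma -> nat -> R) (xb : 'I_Mb -> nat -> R) :
  1 <= alpha -> 0 < e -> (0 < Ma)%N -> decoder n ga -> decoder n gb ->
  \sum_a perr n ga (xa a) a <= Ma%:R * e ->
  \sum_a \sum_b perr n gb (fun t => xb b t + alpha * xa a t) b <= (Ma * Mb)%:R * e ->
  exists2 g : RS -> 'I_Ma * 'I_Mb, decoder n g &
    \sum_a \sum_b perr n g (fun t => xb b t + alpha * xa a t) (a, b) <= (Ma * Mb)%:R * (3 * e).
Proof.
move=> a1 e0 Ma0 dga dgb ea eb.
have al0 : 0 < alpha by exact: lt_le_trans a1.
pose beta := Num.sqrt (1 - alpha^-1 ^+ 2).
have ai1 : alpha^-1 ^+ 2 <= 1 by rewrite expr_le1 ?invr_ge0 ?(ltW al0)// invf_le1.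
have ab1 : alpha^-1 ^+ 2 + beta ^+ 2 = 1.
  by rewrite sqr_sqrtr ?subr_ge0// addrC subrK.
pose h a (p : RS * RS) : \bar R :=
  ((ga (fun t => xa a t + (alpha^-1 * p.2 t + beta * p.1 t)) != a)%:R : R)%:E.
have mh a : measurable_fun setT (h a).
  apply: (measurableT_comp (measurable_fiberN (dga.1 a))).
  apply: measurable_addseq; first exact: (measurable_cst (xa a : RS)).
  by apply: measurable_affine_seq.
have h0 a p : (0 <= h a p)%E by rewrite lee_fin.
pose F a w := (\int[giid R n]_z h a (w, z))%E.
have mF a : measurable_fun setT (F a).
  exact: (@measurable_fun_fubini_tonelli_F _ _ _ _ _ (giid R n) (h a)).
have F0 a w : (0 <= F a w)%E by apply: integral_ge0.
(* By rotation invariance [z / alpha + beta * w] is again standard noise, so the mean over [w] is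
   the error of [ga] on its own channel. *)
have intF a : (\int[giid R n]_w F a w = (perr n ga (xa a) a)%:E)%E.
  rewrite perrK// /F (@fubini_tonelli _ _ _ _ _ (giid R n) (giid R n) (h a))//.
  apply: (@integral_giid_rot R n alpha^-1 beta
    (fun y => ((ga (fun t => xa a t + y t) != a)%:R : R)%:E)) => //.
  - by rewrite invr_gt0.
  - exact: sqrtr_ge0.
  - exact: mberr dga.
(* The mean is at most [Ma * e]; the bound [2 * e] gives the strict inequality from which a suitable
   [w] is extracted. *)
have [w Fw] : exists w, (\sum_a F a w < (Ma%:R * (2 * e))%:E)%E.
  apply: (@exists_lt_integral _ _ R (giid R n)).
  - exact: emeasurable_sum.
  - by move=> w; rewrite sume_ge0.
  - by rewrite !mulr_ge0// ltW.
  rewrite ge0_integral_sum//.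
  under eq_bigr do rewrite intF.
  rewrite sumEFin lte_fin; apply: le_lt_trans ea _.
  by rewrite ltr_pM2l ?ltr0n//; lra.
pose fa b (y : RS) : RS := fun t => 1 * (- alpha^-1 * xb b t + beta * w t) + alpha^-1 * y t.
pose g (y : RS) : 'I_Ma * 'I_Mb := (ga (fa (gb y) y), gb y).
have dfa b : decoder n (ga \o fa b).
  apply: decoder_comp => //; first exact: measurable_affineK.
  by move=> y y' yy' t tn; rewrite /fa yy'.
have dg : decoder n g.
  split=> [[a b]|y y' yy'].
    rewrite [X in measurable X](_ : _ = [set y | gb y = b] `&` [set y | (ga \o fa b) y = a]).
      by apply: measurableI; [exact: dgb.1|exact: (dfa b).1].
    by apply/seteqP; split=> y /=; rewrite /g; [case=> <- <-|case=> -> ->].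
  rewrite /g (dgb.2 _ _ yy'); congr (_, _); exact: (dfa _).2.
exists g => //.
(* The pair is wrong only if [gb] errs or if [ga] errs after the correct codeword [xb b] has been
   removed. Summed over the messages this gives [e + 2 * e = 3 * e]. *)
have FE a b : perr n g (fun t => xb b t + alpha * xa a t) (a, b) <=
    perr n gb (fun t => xb b t + alpha * xa a t) b + fine (F a w).
  have Ffin : F a w \is a fin_num.
    apply: integral_bool_fin.
    exact: (measurableT_comp (mh a) (measurable_pair1 _)).
  rewrite -lee_fin EFinD (fineK Ffin) (perrK _ _ dg) (perrK _ _ dgb) -ge0_integralD//; last 2 first.
  - exact: mberr dgb.
  - exact: (measurableT_comp (mh a) (measurable_pair1 _)).
  apply: ge0_le_integral => //.
  - exact: mberr dg.
  - apply: emeasurable_funD; first exact: mberr dgb.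
    exact: (measurableT_comp (mh a) (measurable_pair1 _)).
  - move=> z _; rewrite /h/= -EFinD lee_fin /g xpair_eqE negb_and.
    case: (boolP (gb _ == b)) => [/eqP gbE|_] /=; last by rewrite orbT lerDl.
    rewrite orbF add0r gbE (_ : fa b _ = fun t => xa a t + (alpha^-1 * z t + beta * w t))//.
    by apply/funext => t; rewrite /fa; field; lra.
apply: (@le_trans _ _ (\sum_a \sum_b (perr n gb (fun t => xb b t + alpha * xa a t) b + fine (F a w)))).
  by apply: ler_sum => a _; apply: ler_sum => b _.
under eq_bigr do rewrite big_split/= sumr_const card_ord.
rewrite big_split/=.
have : \sum_a fine (F a w) *+ Mb <= (Ma * Mb)%:R * (2 * e).
  rewrite sumrMnl natrM mulrAC -[leLHS]mulr_natr; apply: ler_wpM2r => //.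
  rewrite -lee_fin -sumEFin (le_trans _ (ltW Fw))//; apply: lee_sum => a _.
  by rewrite fineK// integral_bool_fin//; exact: (measurableT_comp (mh a) (measurable_pair1 _)).
lra.
Qed.

Lemma mac_rate_converse (alpha Pa Pb T : R) : 1 <= alpha -> 0 < Pa -> 0 < Pb ->
  ln (1 + (alpha ^+ 2 * Pa + Pb)) / 2 < T ->
  exists2 e : R, 0 < e & exists N : nat, forall n (Ma Mb : nat)
    (ga : RS -> 'I_Ma) (gb : RS -> 'I_Mb) (xa : 'I_Ma -> nat -> R) (xb : 'I_Mb -> nat -> R),
    (N <= n)%N -> decoder n ga -> decoder n gb ->
    (forall a, energy n (xa a) <= n%:R * Pa) -> (forall b, energy n (xb b) <= n%:R * Pb) ->
    \sum_a perr n ga (xa a) a <= Ma%:R * e ->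
    \sum_a \sum_b perr n gb (fun t => xb b t + alpha * xa a t) b <= (Ma * Mb)%:R * e ->
    (Ma * Mb)%:R < expR (n%:R * T).
Proof.
move=> a1 Pa0 Pb0 hT.
have S0 : 0 < alpha ^+ 2 * Pa + Pb by rewrite addr_gt0// mulr_gt0// exprn_gt0// (lt_le_trans _ a1).
have [e e0 [N HN]] := rate_converse S0 hT.
(* The joint decoder triples the error, and [rate_converse] excludes error [e] for the superposed
   code. *)
exists (e / 3); first lra.
exists N => n Ma Mb ga gb xa xb Nn dga dgb Ea Eb ea eb.
rewrite ltNge; apply/negP => TM.
have [Ma0 Mb0] : (0 < Ma)%N /\ (0 < Mb)%N.
  have : 0 < (Ma * Mb)%:R :> R by apply: lt_le_trans TM; exact: expR_gt0.
  by rewrite ltr0n muln_gt0 => /andP[].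
have e30 : 0 < e / 3 by rewrite divr_gt0.
have [g dg gE] := exists_joint_decoder a1 e30 Ma0 dga dgb ea eb.
pose m t : R := (\sum_b xb b t) / Mb%:R + alpha * ((\sum_a xa a t) / Ma%:R).
pose x (j : 'I_Ma * 'I_Mb) t := xb j.2 t + alpha * xa j.1 t - m t.
have dg' : decoder n (g \o (fun y => (fun t => 1 * m t + 1 * y t) : RS)).
  apply: decoder_comp => //; first exact: measurable_affineK.
  by move=> y y' yy' t tn; rewrite yy'.
have cardJ : #|{: 'I_Ma * 'I_Mb}| = (Ma * Mb)%N by rewrite card_prod !card_ord.
have := HN n _ _ x Nn dg'.1 dg'.2; rewrite cardJ => H.
have : (Ma * Mb)%:R * e < \sum_j perr n (g \o (fun y => (fun t => 1 * m t + 1 * y t) : RS)) (x j) j.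
  apply: H => //; rewrite -(pair_bigA _ (fun a b => energy n (x (a, b))))/= /energy.
  under eq_bigr do rewrite exchange_big/=.
  rewrite exchange_big/=.
  apply: (@le_trans _ _ (\sum_(t < n) (Ma%:R * \sum_b (xb b t) ^+ 2 +
      Mb%:R * (alpha ^+ 2 * \sum_a (xa a t) ^+ 2)))).
    by apply: ler_sum => t _; exact: (centered_energy alpha (xa^~ t) (xb^~ t) Ma0 Mb0).
  rewrite big_split/= -!mulr_sumr.
  rewrite exchange_big/= [X in _ + _ * (_ * X)]exchange_big/=.
  have hb : \sum_b energy n (xb b) <= Mb%:R * (n%:R * Pb).
    by rewrite mulr_natl -[X in _ *+ X](card_ord Mb) -sumr_const; apply: ler_sum.
  have ha : \sum_a energy n (xa a) <= Ma%:R * (n%:R * Pa).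
    by rewrite mulr_natl -[X in _ *+ X](card_ord Ma) -sumr_const; apply: ler_sum.
  apply: (@le_trans _ _ (Ma%:R * (Mb%:R * (n%:R * Pb)) + Mb%:R * (alpha ^+ 2 * (Ma%:R * (n%:R * Pa))))).
    apply: lerD; first exact: ler_wpM2l.
    by do 2 (apply: ler_wpM2l; rewrite ?sqr_ge0//).
  by rewrite natrM le_eqVlt; apply/orP; left; apply/eqP; ring.
rewrite -(pair_bigA _ (fun a b => perr n _ (x (a, b)) (a, b)))/=.
under eq_bigr do under eq_bigr do rewrite perr_shift.
rewrite ltNge; apply/negP/negPn; apply: le_trans gE _.
by rewrite (_ : 3 * (e / 3) = e)//; field.
Qed.

Lemma awgn_rate_converse (P T : R) : 0 < P -> ln (1 + P) / 2 < T ->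
  exists2 e : R, 0 < e & exists N : nat, forall n (M : nat)
    (g : RS -> 'I_M) (x : 'I_M -> nat -> R),
    (N <= n)%N -> decoder n g -> (forall j, energy n (x j) <= n%:R * P) ->
    \sum_j perr n g (x j) j <= M%:R * e -> M%:R < expR (n%:R * T).
Proof.
move=> P0 hT; have [e e0 [N HN]] := rate_converse P0 hT.
exists e => //; exists N => n M g x Nn dg E ee.
rewrite ltNge; apply/negP => TM.
have := HN n _ _ x Nn dg.1 dg.2; rewrite card_ord => H.
suff : M%:R * e < \sum_j perr n g (x j) j by rewrite ltNge ee.
by apply: H => //; rewrite mulr_natl -[X in _ *+ X](card_ord M) -sumr_const; apply: ler_sum.
Qed.

End mac_converse.

(** * Rate bounds for codes of the interference channel *)

Section converse.
Context (R : realType).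
Local Notation RS := (mseq (measurableTypeR R)).

Lemma borel_n_measurable n (A : set RS) : borel_n n A -> measurable A.
Proof.
apply: smallest_sub; first exact: sigma_algebra_measurable.
move=> _ [B [mB ->]].
rewrite [X in measurable X](_ : _ = \bigcap_(t in [set t | (t < n)%N])
    (fun s : RS => s t) @^-1` (B t)); last by [].
apply: bigcap_measurableType => t _.
have := @measurable_coord _ (measurableTypeR R) t measurableT (B t) (mB t).
by rewrite setTI.
Qed.

(** Invariance under changes beyond position [n] passes to complements, since agreement of two
    signals is symmetric, and to countable unions; the generating cylinders have it. *)
Lemma borel_n_local n (A : set (nat -> R)) : borel_n n A ->
  forall y y', (forall t, (t < n)%N -> y t = y' t) -> A y -> A y'.
Proof.
pose loc : set (set (nat -> R)) := [set A | forall y y', (forall t, (t < n)%N -> y t = y' t) -> A y -> A y'].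
suff : borel_n n `<=` loc by move=> h /h.
apply: smallest_sub; last first.
  by move=> _ [B [mB ->]] y y' yy' /= By t tn; rewrite -yy'//; exact: By.
split => //.
- by move=> B lB y y' yy' [_ nB]; split=> // /lB; move/(_ y) => h; apply: nB; apply: h => t /yy'.
- by move=> F lF y y' yy' [k _ Fk]; exists k => //; exact: lF Fk.
Qed.

Lemma borel_n_decoder n M (g : RS -> 'I_M) :
  (forall w, borel_n n [set y | g y = w]) -> decoder n g.
Proof.
move=> bg; split=> [j|y y' yy']; first exact: borel_n_measurable (bg j).
by have /(_ erefl) /= := @borel_n_local n _ (bg (g y)) y y' yy'.
Qed.

Lemma dec_errE n M (g : RS -> 'I_M) (x : nat -> R) w : decoder n g ->
  dec_err n g x w = (perr n g x w)%:E.
Proof.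
move=> dg; rewrite perrK// /dec_err.
rewrite (_ : (fun z => _) = fun z : RS => ((g (fun t => x t + z t) != w)%:R : R)%:E); last first.
  by apply/funext => z; case: (_ != _).
apply: gauss_intE; first exact: mberr dg.
by move=> z; rewrite lee_fin.
Qed.

Lemma avgE M1 M2 M3 (f : 'I_M1 -> 'I_M2 -> 'I_M3 -> R) :
  avg (fun w1 w2 w3 => (f w1 w2 w3)%:E) =
  ((\sum_w1 \sum_w2 \sum_w3 f w1 w2 w3) / (M1 * M2 * M3)%:R)%:E.
Proof.
rewrite /avg EFinM; congr (_ * _)%E.
rewrite -sumEFin; apply: eq_bigr => w1 _; rewrite -sumEFin; apply: eq_bigr => w2 _.
by rewrite -sumEFin.
Qed.

Section code_errors.
Variables (a1 a2 P1 P2 P3 : R) (n M1 M2 M3 : nat) (c : Defs.code R n M1 M2 M3).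
Hypothesis okc : code_ok P1 P2 P3 c.

(** Decoders are total maps, so their value at the zero signal inhabits the message set. *)
Lemma code_size_gt0 : [/\ (0 < M1)%N, (0 < M2)%N & (0 < M3)%N].
Proof.
split; [case: (dec1 c (fun _ => 0))|case: (dec2 c (fun _ => 0))|case: (dec3 c (fun _ => 0))];
  by move=> k; exact: leq_ltn_trans.
Qed.

Lemma code_decoders : [/\ decoder n (dec1 c), decoder n (dec2 c) & decoder n (dec3 c)].
Proof. by case: okc => _ _ _ [? ? ?]; split; exact: borel_n_decoder. Qed.

Let Mgt0 : [/\ (0 < M1%:R :> R), (0 < M2%:R :> R) & (0 < M3%:R :> R)].
Proof. by case: code_size_gt0 => *; rewrite !ltr0n. Qed.

Lemma err1E e : (err1 c <= e%:E)%E = (\sum_w perr n (dec1 c) (enc1 c w) w <= M1%:R * e).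
Proof.
case: code_decoders Mgt0 => d1 d2 d3 [m1 m2 m3].
rewrite /err1; under eq_fun do under eq_fun do under eq_fun do rewrite dec_errE//.
rewrite avgE lee_fin; under eq_bigr do under eq_bigr do rewrite sumr_const card_ord.
under eq_bigr do rewrite sumr_const card_ord.
rewrite !sumrMnl -mulrnA -[X in X / _]mulr_natl ler_pdivrMr ?natrM ?mulr_gt0//.
rewrite (_ : e * _ = M3%:R * M2%:R * (M1%:R * e)); last by ring.
by rewrite ler_pM2l ?mulr_gt0.
Qed.

Lemma err2E e : (err2 a1 c <= e%:E)%E =
  (\sum_w1 \sum_w2 perr n (dec2 c) (fun t => enc2 c w2 t + a1 * enc1 c w1 t) w2 <= (M1 * M2)%:R * e).
Proof.
case: code_decoders Mgt0 => d1 d2 d3 [m1 m2 m3].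
rewrite /err2; under eq_fun do under eq_fun do under eq_fun do rewrite dec_errE//.
rewrite avgE lee_fin; under eq_bigr do under eq_bigr do rewrite sumr_const card_ord.
under eq_bigr do rewrite sumrMnl.
rewrite sumrMnl -[X in X / _]mulr_natl ler_pdivrMr ?natrM ?mulr_gt0//.
rewrite (_ : e * _ = M3%:R * (M1%:R * M2%:R * e)); last by ring.
by rewrite ler_pM2l ?mulr_gt0.
Qed.

Lemma err3E e : (err3 a2 c <= e%:E)%E =
  (\sum_w2 \sum_w3 perr n (dec3 c) (fun t => enc3 c w3 t + a2 * enc2 c w2 t) w3 <= (M2 * M3)%:R * e).
Proof.
case: code_decoders Mgt0 => d1 d2 d3 [m1 m2 m3].
rewrite /err3; under eq_fun do under eq_fun do under eq_fun do rewrite dec_errE//.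
rewrite avgE lee_fin sumr_const card_ord -[X in X / _]mulr_natl ler_pdivrMr ?natrM ?mulr_gt0//.
rewrite (_ : e * _ = M1%:R * (M2%:R * M3%:R * e)); last by ring.
by rewrite ler_pM2l ?mulr_gt0.
Qed.

End code_errors.

Lemma exists_le_average (M : nat) (f : 'I_M -> R) (K : R) : (0 < M)%N ->
  \sum_i f i <= M%:R * K -> exists i, f i <= K.
Proof.
move=> M0 fK; apply: contrapT => /forallNP fN.
have : \sum_(i < M) K < \sum_i f i.
  apply: ltr_sum; first by apply/hasP; exists (Ordinal M0); rewrite ?mem_index_enum.
  by move=> i _; rewrite ltNge; apply/negP; exact: fN.
by rewrite sumr_const card_ord -mulr_natl ltNge fK.
Qed.

(** Moves a frozen interfering codeword from the channel into the decoder; what remains is an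
    interference-free Gaussian channel. *)
Definition add_interference (v : nat -> R) (a : R) (y : RS) : RS := fun t => a * v t + 1 * y t.

Lemma decoder_interference (J : eqType) n (g : RS -> J) (v : nat -> R) (a : R) :
  decoder n g -> decoder n (g \o add_interference v a).
Proof.
move=> dg; apply: decoder_comp => //; first exact: measurable_affineK.
by move=> y y' yy' t tn; rewrite /add_interference yy'.
Qed.

Lemma perr_interference (J : eqType) n (g : RS -> J) (v x : nat -> R) (a : R) j :
  perr n (g \o add_interference v a) x j = perr n g (fun t => x t + a * v t) j.
Proof.
congr fine; apply: eq_integral => z _ /=; congr (((g _) != j)%:R)%:E.
by apply/funext => t; rewrite /add_interference; ring.
Qed.

Lemma powR2E (x : R) : 2 `^ x = expR (x * ln 2).
Proof. by rewrite /powR gt_eqF. Qed.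

Lemma ltCgE (r x : R) : (Cg x < r) = (ln (1 + x) / 2 < r * ln 2).
Proof.
have l2 : 0 < ln 2 :> R by rewrite ln_gt0 ?ltr1n.
by rewrite /Cg invfM mulrA ltr_pdivrMr.
Qed.

Lemma achievable_bounds (a1 a2 P1 P2 P3 R1 R2 R3 : R) :
  0 < P1 -> 0 < P2 -> 0 < P3 -> 1 <= a1 -> 1 <= a2 ->
  achievable a1 a2 P1 P2 P3 (R1, R2, R3) ->
  [/\ R1 <= Cg P1, R2 <= Cg P2, R3 <= Cg P3,
    R1 + R2 <= Cg (a1 ^+ 2 * P1 + P2) & R2 + R3 <= Cg (a2 ^+ 2 * P2 + P3)].
Proof.
move=> P1_gt0 P2_gt0 P3_gt0 a1_ge1 a2_ge1 [_ _ _ ach].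
split; rewrite leNgt; apply/negP; rewrite ltCgE.
- move=> /(awgn_rate_converse P1_gt0)[e e0 [N HN]].
  have [N' /(_ (maxn N N') (leq_maxr _ _))] := ach e e0.
  set n := maxn N N' => -[M1 [M2 [M3 [c [okc m1 m2 m3 [e1 e2 e3]]]]]].
  have [d1 d2 d3] := code_decoders okc; have [E1 E2 E3 _] := okc.
  move: e1; rewrite (err1E okc) => e1.
  have := HN n _ _ _ (leq_maxl _ _) d1 E1 e1.
  by rewrite ltNge; apply/negP/negPn; rewrite mulrA -powR2E.
- move=> /(awgn_rate_converse P2_gt0)[e e0 [N HN]].
  have [N' /(_ (maxn N N') (leq_maxr _ _))] := ach e e0.
  set n := maxn N N' => -[M1 [M2 [M3 [c [okc m1 m2 m3 [e1 e2 e3]]]]]].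
  have [d1 d2 d3] := code_decoders okc; have [E1 E2 E3 _] := okc.
  have [M10 M20 M30] := code_size_gt0 c.
  move: e2; rewrite (err2E _ okc) natrM -mulrA => /(exists_le_average M10)[w e2].
  have := HN n _ _ (enc2 c) (leq_maxl _ _) (decoder_interference (enc1 c w) a1 d2) E2.
  under eq_bigr do rewrite perr_interference.
  move=> /(_ e2); by rewrite ltNge; apply/negP/negPn; rewrite mulrA -powR2E.
- move=> /(awgn_rate_converse P3_gt0)[e e0 [N HN]].
  have [N' /(_ (maxn N N') (leq_maxr _ _))] := ach e e0.
  set n := maxn N N' => -[M1 [M2 [M3 [c [okc m1 m2 m3 [e1 e2 e3]]]]]].
  have [d1 d2 d3] := code_decoders okc; have [E1 E2 E3 _] := okc.
  have [M10 M20 M30] := code_size_gt0 c.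
  move: e3; rewrite (err3E _ okc) natrM -mulrA => /(exists_le_average M20)[w e3].
  have := HN n _ _ (enc3 c) (leq_maxl _ _) (decoder_interference (enc2 c w) a2 d3) E3.
  under eq_bigr do rewrite perr_interference.
  move=> /(_ e3); by rewrite ltNge; apply/negP/negPn; rewrite mulrA -powR2E.
- move=> /(mac_rate_converse a1_ge1 P1_gt0 P2_gt0)[e e0 [N HN]].
  have [N' /(_ (maxn N N') (leq_maxr _ _))] := ach e e0.
  set n := maxn N N' => -[M1 [M2 [M3 [c [okc m1 m2 m3 [e1 e2 e3]]]]]].
  have [d1 d2 d3] := code_decoders okc; have [E1 E2 E3 _] := okc.
  move: e1 e2; rewrite (err1E okc) (err2E _ okc) => e1 e2.
  have := HN n _ _ _ _ _ _ (leq_maxl _ _) d1 d2 E1 E2 e1 e2.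
  rewrite ltNge; apply/negP/negPn.
  rewrite mulrDl mulrDr expRD !mulrA -!powR2E natrM.
  by apply: ler_pM => //; exact: powR_ge0.
- move=> /(mac_rate_converse a2_ge1 P2_gt0 P3_gt0)[e e0 [N HN]].
  have [N' /(_ (maxn N N') (leq_maxr _ _))] := ach e e0.
  set n := maxn N N' => -[M1 [M2 [M3 [c [okc m1 m2 m3 [e1 e2 e3]]]]]].
  have [d1 d2 d3] := code_decoders okc; have [E1 E2 E3 _] := okc.
  have [M10 M20 M30] := code_size_gt0 c.
  (* Receiver 2 still hears user 1. Freezing that user at a codeword whose conditional error is no
     worse than the average makes receiver 2 a clean receiver for user 2, and receiver 3, which does
     not hear user 1, is unaffected. *)
  move: e2 e3; rewrite (err2E _ okc) (err3E _ okc) natrM -mulrA => /(exists_le_average M10)[w e2] e3.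
  have := HN n _ _ _ _ (enc2 c) (enc3 c) (leq_maxl _ _) (decoder_interference (enc1 c w) a1 d2) d3 E2 E3.
  under eq_bigr do rewrite perr_interference.
  move=> /(_ e2 e3); rewrite ltNge; apply/negP/negPn.
  rewrite mulrDl mulrDr expRD !mulrA -!powR2E natrM.
  by apply: ler_pM => //; exact: powR_ge0.
Qed.

End converse.

(** * Random Gaussian codebooks *)

Section gauss_semigroup.
Context (R : realType).
Local Notation RS := (mseq (measurableTypeR R)).

(* Up to the factor (2 pi)^(-n/2), the density of N(0, v)^n; convolving with N(0, s^2)^n adds
   variances. *)
Definition gpot n (v : R) (w : nat -> R) : R :=
  expR (- (n%:R * (ln v / 2)) - energy n w / (2 * v)).

Lemma integral_gpot n (v s : R) (w : nat -> R) : 0 < v -> 0 <= s ->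
  (\int[giid R n]_z (gpot n v (fun t => w t + s * z t)%R)%:E = (gpot n (v + s ^+ 2) w)%:E)%E.
Proof.
move=> v0 s0; have vs0 : 0 < v + s ^+ 2 by rewrite ltr_wpDr ?sqr_ge0.
have DE : 1 + 2 * (2 * v)^-1 * s ^+ 2 = (v + s ^+ 2) / v by field; lra.
have D0 : 0 < 1 + 2 * (2 * v)^-1 * s ^+ 2 by rewrite DE divr_gt0.
transitivity (\int[giid R n]_z ((expR (- (n%:R * (ln v / 2))))%:E *
    (expR (- (2 * v)^-1 * energy n (fun t => w t + s * z t)%R))%:E))%E.
  by apply: eq_integral => z _; rewrite -EFinM -expRD mulNr (mulrC (_^-1)).
rewrite ge0_integralZl; [|exact: measurableT| | |by rewrite lee_fin expR_ge0]; last 2 first.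
- apply/measurable_EFinP; apply: measurableT_comp => //; apply: measurable_funM => //.
  apply: measurable_energy; apply: measurable_addseq; first exact: (measurable_cst (w : RS)).
  exact: (measurable_mulseq s (@measurable_id _ _ setT)).
- by move=> z _; rewrite lee_fin expR_ge0.
rewrite integral_giid_expR// -EFinM; congr EFin.
have -> : (Num.sqrt (1 + 2 * (2 * v)^-1 * s ^+ 2))^-1 = expR (ln v / 2 - ln (v + s ^+ 2) / 2).
  apply/eqP; rewrite -(@eqrXn2 _ 2)// ?invr_ge0 ?sqrtr_ge0 ?expR_ge0//.
  rewrite exprVn sqr_sqrtr ?(ltW D0)// DE -expRM_natl (_ : 2%:R * _ = ln v - ln (v + s ^+ 2)); last by field.
  by rewrite expRB !lnK ?posrE// invf_div.
rewrite -expRM_natl -!expRD /gpot DE; congr expR.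
by field; lra.
Qed.

Lemma gpotN n (v : R) (w w' : nat -> R) : (forall t, w t = - w' t) -> gpot n v w = gpot n v w'.
Proof.
move=> ww'; rewrite /gpot (_ : energy n w = energy n w')//.
by apply: eq_bigr => t _; rewrite ww' sqrrN.
Qed.

Lemma gpot0 n (v : R) : gpot n v (fun _ => 0) = expR (- (n%:R * (ln v / 2))).
Proof. by rewrite /gpot /energy big1 ?mul0r ?subr0// => t _; rewrite expr0n. Qed.

Lemma measurable_gpot d (T : measurableType d) n v (f : T -> RS) :
  measurable_fun setT f -> measurable_fun setT (fun x => gpot n v (f x)).
Proof.
move=> mf; rewrite /gpot; apply: measurableT_comp => //; apply: measurable_funB => //.
by apply: measurable_funM => //; exact: measurable_energy.
Qed.

End gauss_semigroup.

Section codebook.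
Context (R : realType).
Local Notation RS := (mseq (measurableTypeR R)).
Local Notation CS := (mseq RS).
Variables (n N : nat).

Definition codebook : probability CS R := iid ((fun _ => 0) : RS) (giid R n) N.

Lemma integral_codebook_le i (F : CS -> \bar R) (K : \bar R) : (i < N)%N ->
  measurable_fun setT F -> (forall c, 0 <= F c)%E ->
  (forall c, \int[giid R n]_v F (upd c i v) <= K)%E ->
  (\int[codebook]_c F c <= K)%E.
Proof.
move=> iN mF F0 FK; rewrite /codebook (integral_resample _ _ iN mF F0).
have K0 : (0 <= K)%E.
  by apply: le_trans (FK (fun _ _ => 0)); exact: integral_ge0.
have -> : K = (\int[codebook]_c cst K c)%E.
  by rewrite integral_prob_cst.
apply: ge0_le_integral => //.
- by move=> c _; exact: integral_ge0.
- apply: (@measurable_fun_fubini_tonelli_F _ _ _ _ _ (giid R n)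
    (fun p : CS * RS => F (upd p.1 i p.2))) => //.
  by apply: (measurableT_comp mF); exact: measurable_upd.
Qed.

(** Bundles the side conditions of Tonelli's theorem with the bound on the double mean, so that
    error events can be treated one at a time and added. *)
Definition mean_le (B : CS * RS -> R) (K : R) :=
  [/\ measurable_fun setT B, forall p, 0 <= B p &
      (\int[codebook]_c \int[giid R n]_z (B (c, z))%:E <= K%:E)%E].

Let mB1 (B : CS * RS -> R) c : measurable_fun setT B ->
  measurable_fun setT (fun z => (B (c, z))%:E).
Proof. by move=> mB; apply/measurable_EFinP; exact: measurableT_comp mB (measurable_pair1 _). Qed.

Let mB2 (B : CS * RS -> R) : measurable_fun setT B -> (forall p, 0 <= B p) ->
  measurable_fun setT (fun c => \int[giid R n]_z (B (c, z))%:E)%E.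
Proof.
move=> mB B0; apply: (@measurable_fun_fubini_tonelli_F _ _ _ _ _ (giid R n) (EFin \o B)).
  exact/measurable_EFinP.
by move=> p; rewrite lee_fin.
Qed.

Lemma mean_leD B1 B2 K1 K2 : mean_le B1 K1 -> mean_le B2 K2 ->
  mean_le (fun p => B1 p + B2 p) (K1 + K2).
Proof.
move=> [m1 p1 h1] [m2 p2 h2]; split=> [|p|].
- exact: measurable_funD.
- exact: addr_ge0.
under eq_integral.
  move=> c _; under eq_integral do rewrite EFinD.
  rewrite ge0_integralD//; [|by move=> z _; rewrite lee_fin|exact: mB1|by move=> z _; rewrite lee_fin|exact: mB1].
  over.
rewrite ge0_integralD//; last 4 first.
- by move=> c _; apply: integral_ge0 => z _; rewrite lee_fin.
- exact: mB2.
- by move=> c _; apply: integral_ge0 => z _; rewrite lee_fin.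
- exact: mB2.
by rewrite EFinD; exact: leeD.
Qed.

Lemma mean_le_scale B K k : 0 <= k -> mean_le B K -> mean_le (fun p => k * B p) (k * K).
Proof.
move=> k0 [m1 p1 h1]; split=> [|p|].
- exact: measurable_funM.
- exact: mulr_ge0.
under eq_integral.
  move=> c _; under eq_integral do rewrite EFinM.
  rewrite ge0_integralZl//; [|exact: mB1|by move=> z _; rewrite lee_fin].
  over.
rewrite ge0_integralZl//; last 2 first.
- exact: mB2.
- by move=> c _; apply: integral_ge0 => z _; rewrite lee_fin.
by rewrite EFinM; apply: lee_wpmul2l.
Qed.

Lemma mean_le0 : mean_le (fun _ => 0) 0.
Proof.
split=> //; rewrite integral0_eq// => c _; by rewrite integral0_eq.
Qed.

Lemma mean_le_sum (I : finType) (P : pred I) (B : I -> CS * RS -> R) K :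
  (forall i, P i -> mean_le (B i) K) ->
  mean_le (fun p => \sum_(i | P i) B i p) (\sum_(i | P i) K).
Proof.
move=> H.
have -> : (fun p => \sum_(i | P i) B i p) = \sum_(i | P i) B i.
  by apply/funext => p; rewrite fct_sumE.
elim/big_rec2 : _ => [|i K' B' Pi h]; first exact: mean_le0.
exact: mean_leD (H i Pi) h.
Qed.

Lemma mean_leW B K K' : K <= K' -> mean_le B K -> mean_le B K'.
Proof. by move=> KK' [m p h]; split=> //; apply: le_trans h _; rewrite lee_fin. Qed.

Lemma mean_le_noise (B : CS * RS -> R) (K : R) : measurable_fun setT B -> (forall p, 0 <= B p) ->
  (forall c, \int[giid R n]_z (B (c, z))%:E <= K%:E)%E -> mean_le B K.
Proof.
move=> mB B0 h; split=> //.
apply: (@le_trans _ _ (\int[codebook]_c cst K%:E c)%E).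
  apply: ge0_le_integral => //; last by exact: mB2.
  by move=> c _; apply: integral_ge0 => z _; rewrite lee_fin.
by rewrite integral_prob_cst.
Qed.

Lemma mean_le_swap (B : CS * RS -> R) (K : R) : measurable_fun setT B -> (forall p, 0 <= B p) ->
  (forall z, \int[codebook]_c (B (c, z))%:E <= K%:E)%E -> mean_le B K.
Proof.
move=> mB B0 h; split=> //.
have mEB : measurable_fun setT (EFin \o B) by exact/measurable_EFinP.
have B0' p : (0 <= (EFin \o B) p)%E by rewrite lee_fin.
rewrite (@fubini_tonelli _ _ _ _ _ codebook (giid R n) (EFin \o B) mEB B0').
apply: (@le_trans _ _ (\int[giid R n]_z cst K%:E z)%E).
  apply: ge0_le_integral => //.
  - by move=> c _; apply: integral_ge0 => z _; rewrite lee_fin.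
  - exact: (@measurable_fun_fubini_tonelli_G _ _ _ _ _ codebook (EFin \o B) mEB B0').
  - by move=> z _; exact: h.
by rewrite integral_prob_cst.
Qed.

Lemma mean_le_exists B K K' : mean_le B K -> K < K' ->
  exists c, (\int[giid R n]_z (B (c, z))%:E < K'%:E)%E.
Proof.
move=> [mB B0 BK] KK'.
apply: (@exists_lt_integral _ _ R codebook (fun c => \int[giid R n]_z (B (c, z))%:E)%E).
- exact: mB2.
- by move=> c; apply: integral_ge0 => z _; rewrite lee_fin.
- apply: le_trans (ltW KK'); rewrite -lee_fin; apply: le_trans BK.
  by apply: integral_ge0 => c _; apply: integral_ge0 => z _; rewrite lee_fin.
- by apply: le_lt_trans BK _; rewrite lte_fin.
Qed.

End codebook.

(** * Threshold decoding *)

Section receiver.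
Context (R : realType).
Local Notation RS := (mseq (measurableTypeR R)).
Local Notation CS := (mseq RS).
Variables (n N Ma Mb : nat) (sa sb d : R) (ia : 'I_Ma -> nat) (ib : 'I_Mb.+1 -> nat).

Definition noiseless (c : CS) wa wb : nat -> R := fun t => sb * c (ib wb) t + sa * c (ia wa) t.

Definition received (p : CS * RS) wa wb : nat -> R := fun t => noiseless p.1 wa wb t + p.2 t.

(** The residual with reversed sign, the own codeword added last: this fits the shape [w + s * c i]
    averaged in [integral_codebook_gpot]. *)
Definition residual (c : CS) (y : nat -> R) wa wb : nat -> R :=
  fun t => (sa * c (ia wa) t - y t) + sb * c (ib wb) t.

(** The interfering message is quantified away: a pair with the right own message and a wrong
    interfering one does no harm, so only the own rate and the sum rate get constrained. When
    nothing passes the default is [ord0]; this can happen only if the true pair fails the test. *)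
Definition threshold_decoder (c : CS) (y : nat -> R) : 'I_Mb.+1 :=
  odflt ord0 [pick wb | [exists wa, energy n (residual c y wa wb) <= n%:R * (1 + d)]].

Lemma borel_n_coord t : (t < n)%N ->
  measurable_fun [set: g_sigma_algebraType [set A | exists B : nat -> set R,
          (forall t, measurable (B t)) /\
          A = [set y : nat -> R | forall t, (t < n)%N -> B t (y t)]]] (fun y => y t : R).
Proof.
move=> tn _ B mB; rewrite setTI; apply: sub_sigma_algebra.
exists (fun k => if k == t then B else setT); split=> [k|]; first by case: ifP.
apply/seteqP; split=> y /= h; last by have := h t tn; rewrite eqxx.
by move=> k kn; case: eqP => // ->.
Qed.

(** A decision taken from finitely many measurable tests is constant on each pattern of outcomes,
    and there are finitely many patterns. *)
Lemma finite_test_measurable d' (T : measurableType d') (K : finType) (p : K -> T -> bool)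
  (U : eqType) (phi : {ffun K -> bool} -> U) u :
  (forall k, measurable_fun setT (p k)) ->
  measurable [set y | phi [ffun k => p k y] = u].
Proof.
move=> mp.
rewrite [X in measurable X](_ : _ = \bigcup_(b in [set b | phi b = u])
    \bigcap_(k in [set: K]) (p k @^-1` [set b k])); last first.
  apply/seteqP; split=> y /=.
    by move=> py; exists [ffun k => p k y] => //= k _; rewrite ffunE.
  move=> [b <- pb]; congr phi; apply/ffunP => k; rewrite ffunE; exact: pb.
apply: fin_bigcup_measurable => [|b _]; first exact: finite_finset.
apply: fin_bigcap_measurable => [|k _]; first exact: finite_finset.
by rewrite -[X in measurable X]setTI; exact: mp.
Qed.

Lemma threshold_decoder_borel c w : borel_n n [set y | threshold_decoder c y = w].
Proof.
pose p (k : 'I_Ma * 'I_Mb.+1) (y : nat -> R) := energy n (residual c y k.1 k.2) <= n%:R * (1 + d).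
pose phi (b : {ffun 'I_Ma * 'I_Mb.+1 -> bool}) : 'I_Mb.+1 :=
  odflt ord0 [pick wb | [exists wa, b (wa, wb)]].
have E y : threshold_decoder c y = phi [ffun k => p k y].
  rewrite /threshold_decoder /phi; congr odflt; apply: eq_pick => wb /=.
  by apply: eq_existsb => wa; rewrite ffunE.
under eq_set do rewrite E.
apply: (@finite_test_measurable _ (g_sigma_algebraType [set A | exists B : nat -> set R,
          (forall t, measurable (B t)) /\
          A = [set y : nat -> R | forall t, (t < n)%N -> B t (y t)]])) => k.
apply: measurable_fun_ler => //.
apply: measurable_sum => t; apply: measurable_funX; apply: measurable_funD => //.
by apply: measurable_funB => //; exact: borel_n_coord.
Qed.


Lemma energyN m (v w : nat -> R) : (forall t, v t = - w t) -> energy m v = energy m w.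
Proof. by move=> vw; apply: eq_bigr => t _; rewrite vw sqrrN. Qed.

(* With e the energy of the observation and s the power of its law, this dominates the indicator that
   the pair (wa, wb) passes the test while e is typical. *)
Definition confusion (s : R) (c : CS) (y : nat -> R) (e : R) wa wb : R :=
  expR (n%:R * d) * (gpot n 1 (residual c y wa wb) * expR (e / (2 * s))).

Let s1 := 1 + sb ^+ 2.
Let s2 := 1 + sb ^+ 2 + sa ^+ 2.

Definition noise_tail (w : RS) : R := expR (d / 4 * (energy n w - n%:R * (1 + d))).

(** With the tilt [d / (2 * s)] this is a multiple of the Gaussian kernel of variance [s / d], so
    its mean comes from the semigroup identity. *)
Definition low_tail (s : R) (w : nat -> R) : R :=
  expR (d / (2 * s) * (n%:R * (s * (1 - d)) - energy n w)).

(** The factor [expR (n * d)] pays exactly for the two slacks [n * d / 2], in the residual and in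
    the energy [e]. *)
Lemma confusion_ge1 s c y e wa wb : 0 < s -> n%:R * (s * (1 - d)) <= e ->
  energy n (residual c y wa wb) <= n%:R * (1 + d) -> 1 <= confusion s c y e wa wb.
Proof.
move=> s0 eL D; rewrite /confusion /gpot ln1 mul0r mulr0 oppr0 add0r mulr1 -!expRD.
apply: le_trans (expR_ge1Dx _); rewrite lerDl.
have : n%:R * (1 - d) <= e / s by rewrite ler_pdivlMr// mulrAC -mulrA.
rewrite (_ : e / (2 * s) = e / s / 2); last by field; lra.
lra.
Qed.

(** Union bound over: strong noise; too weak an observation after or before removal of the true
    interferer, of powers [s1] and [s2]; a wrong own message with the right interferer; both
    messages wrong. *)
Lemma decoding_error_le c z wa wb : 0 < d ->
  (threshold_decoder c (received (c, z) wa wb) != wb)%:R <=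
  noise_tail z + low_tail s1 (fun t => sa * c (ia wa) t - received (c, z) wa wb t) +
  low_tail s2 (received (c, z) wa wb) +
  \sum_(wb' | wb' != wb) confusion s1 c (received (c, z) wa wb)
      (energy n (fun t => sa * c (ia wa) t - received (c, z) wa wb t)) wa wb' +
  \sum_(wb' | wb' != wb) \sum_(wa' | wa' != wa) confusion s2 c (received (c, z) wa wb)
      (energy n (received (c, z) wa wb)) wa' wb'.
Proof.
move=> d0; set y := received _ wa wb; set U := fun t => _ - _.
have s10 : 0 < s1 by rewrite ltr_wpDr ?sqr_ge0.
have s20 : 0 < s2 by rewrite /s2 -addrA ltr_wpDr ?addr_ge0 ?sqr_ge0.
have C0 s e a b : 0 <= confusion s c y e a b.
  by rewrite /confusion /gpot -!expRD expR_ge0.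
have T1 : 0 <= noise_tail z by exact: expR_ge0.
have T2 : 0 <= low_tail s1 U by exact: expR_ge0.
have T3 : 0 <= low_tail s2 y by exact: expR_ge0.
have T4 : 0 <= \sum_(wb' | wb' != wb) confusion s1 c y (energy n U) wa wb' by exact: sumr_ge0.
have T5 : 0 <= \sum_(wb' | wb' != wb) \sum_(wa' | wa' != wa) confusion s2 c y (energy n y) wa' wb'.
  by apply: sumr_ge0 => b _; exact: sumr_ge0.
have tail1 s w : 0 < s -> energy n w < n%:R * (s * (1 - d)) -> 1 <= low_tail s w.
  move=> s0 h; apply: le_trans (expR_ge1Dx _); rewrite lerDl mulr_ge0 ?subr_ge0 ?ltW//.
  by rewrite divr_gt0// mulr_gt0.
case: eqP => [_|/eqP dn]; first by rewrite mulr0n; do ![apply: addr_ge0 => //].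
have [zL|zG] := leP (energy n z) (n%:R * (1 + d)); last first.
  have : 1 <= noise_tail z.
    apply: le_trans (expR_ge1Dx _); rewrite lerDl mulr_ge0 ?subr_ge0 ?(ltW zG)//.
    by rewrite divr_ge0// ltW.
  move: T2 T3 T4 T5; rewrite mulr1n; lra.
have [UL|UG] := ltP (energy n U) (n%:R * (s1 * (1 - d))).
  by have := tail1 _ _ s10 UL; move: T1 T3 T4 T5; rewrite mulr1n; lra.
have [yL|yG] := ltP (energy n y) (n%:R * (s2 * (1 - d))).
  by have := tail1 _ _ s20 yL; move: T1 T2 T4 T5; rewrite mulr1n; lra.
(* The residual of the true pair is [- z], so it passes when the noise is not too strong, and a
   decoding error then comes from another pair that passes. *)
have own : [exists wa', energy n (residual c y wa' wb) <= n%:R * (1 + d)].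
  apply/existsP; exists wa; rewrite (@energyN n _ z)//.
  by move=> t; rewrite /residual /y /received /noiseless/=; ring.
move: dn; rewrite /threshold_decoder; case: pickP => [wb' /existsP[wa' D]|/(_ wb)]; last by rewrite own.
move=> /= wb'n; have [wa'E|wa'n] := eqVneq wa' wa.
  rewrite wa'E in D; have h := confusion_ge1 s10 UG D.
  have : confusion s1 c y (energy n U) wa wb' <= \sum_(wb' | wb' != wb) confusion s1 c y (energy n U) wa wb'.
    by rewrite (bigD1 wb')//= lerDl sumr_ge0.
  by move: T1 T2 T3 T5; rewrite mulr1n; lra.
have h := confusion_ge1 s20 yG D.
have h2 : \sum_(wa' | wa' != wa) confusion s2 c y (energy n y) wa' wb' <=
    \sum_(wb' | wb' != wb) \sum_(wa' | wa' != wa) confusion s2 c y (energy n y) wa' wb'.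
  by rewrite [leRHS](bigD1 wb')//= lerDl; apply: sumr_ge0 => b _; exact: sumr_ge0.
have : confusion s2 c y (energy n y) wa' wb' <= \sum_(wa' | wa' != wa) confusion s2 c y (energy n y) wa' wb'.
  by rewrite (bigD1 wa')//= lerDl sumr_ge0.
by move: T1 T2 T3 T4; rewrite mulr1n; lra.
Qed.

(** * Means of the error terms over codebook and noise *)

Hypotheses (sa0 : 0 <= sa) (sb0 : 0 <= sb) (d0 : 0 < d) (d1 : d <= 1 / 2).
Hypotheses (ia_inj : injective ia) (ib_inj : injective ib) (iab : forall a b, ia a != ib b).
Hypotheses (iaN : forall a, (ia a < N)%N) (ibN : forall b, (ib b < N)%N).

Let s10 : 0 < s1. Proof. by rewrite ltr_wpDr ?sqr_ge0. Qed.
Let s20 : 0 < s2. Proof. by rewrite /s2 -addrA ltr_wpDr ?addr_ge0 ?sqr_ge0. Qed.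

Lemma integral_noise_tail :
  (\int[giid R n]_z (noise_tail z)%:E <= (expR (- (n%:R * (d ^+ 3 / 16))))%:E)%E.
Proof.
have D0 : 0 < 1 + 2 * (- (d / 4)) * 1 ^+ 2.
  by rewrite expr1n mulr1; move: d0 d1; lra.
have E z : noise_tail z = expR (- (d / 4 * (n%:R * (1 + d)))) *
    expR (- (- (d / 4)) * energy n (fun t => 0 + 1 * z t)).
  rewrite -expRD /noise_tail; congr expR.
  rewrite (_ : energy n (fun t => _) = energy n z); first by ring.
  by apply: eq_bigr => t _; rewrite add0r mul1r.
under eq_integral do rewrite E EFinM.
rewrite ge0_integralZl; [|exact: measurableT| |by move=> z _; rewrite lee_fin expR_ge0|by rewrite lee_fin expR_ge0]; last first.
  apply/measurable_EFinP; apply: measurableT_comp => //; apply: measurable_funM => //.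
  apply: measurable_energy; apply: measurable_addseq; first exact: (measurable_cst ((fun _ => 0) : RS)).
  exact: (measurable_mulseq 1 (@measurable_id _ _ setT)).
rewrite (integral_giid_expR n (fun _ => 0) ler01 D0) -EFinM lee_fin.
rewrite (_ : energy n _ = 0); last by rewrite /energy big1// => t _; rewrite expr0n.
rewrite mulr0 expR0 mulr1.
apply: (@le_trans _ _ (expR (- (d / 4 * (n%:R * (1 + d)))) *
    expR (n%:R * (((1 + 2 * - (d / 4) * 1 ^+ 2)^-1 - 1) / 2)))).
  rewrite ler_pM2l ?expR_gt0// expRM_natl; apply: lerXn2r; rewrite ?nnegrE ?invr_ge0 ?sqrtr_ge0 ?expR_ge0//.
  exact: inv_sqrt_le_expR.
rewrite -expRD ler_expR.
(* The exponent per symbol is [d / 4] times the difference between the left side and [1 + d]; the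
   spare [d ^+ 2 / 4] becomes the rate [d ^+ 3 / 16]. *)
have h : (1 + 2 * - (d / 4) * 1 ^+ 2)^-1 <= 1 + d - d ^+ 2 / 4.
  rewrite -[leLHS]mul1r ler_pdivrMr//.
  rewrite [leRHS](_ : _ = 1 + d * (1 / 2 - 3 * d / 4 + d ^+ 2 / 8)); last by field.
  by rewrite lerDl mulr_ge0 ?(ltW d0)//; have := sqr_ge0 d; move: d1; lra.
set D := 1 + 2 * - (d / 4) * 1 ^+ 2 in D0 h *.
have -> : (D^-1 - 1) / 2 = d / 4 * D^-1.
  have D1 : d = 2 * (1 - D) by rewrite /D; field.
  by rewrite [in RHS]D1; field; rewrite gt_eqF.
have : n%:R * (d / 4 * D^-1) <= n%:R * (d / 4 * (1 + d - d ^+ 2 / 4)).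
  by apply: ler_wpM2l => //; apply: ler_wpM2l => //; rewrite divr_ge0// ltW.
have -> : n%:R * (d / 4 * (1 + d - d ^+ 2 / 4)) = d / 4 * (n%:R * (1 + d)) - n%:R * (d ^+ 3 / 16).
  by field.
lra.
Qed.

Lemma low_tailE s : 0 < s -> low_tail s =
  (fun w => expR (n%:R * (d / 2 * (1 - d) + ln (s / d) / 2)) * gpot n (s / d) w).
Proof.
move=> s0; apply/funext => w; rewrite /low_tail /gpot -expRD; congr expR.
by field; rewrite !gt_eqF.
Qed.

Lemma low_tail_rate s : 0 < s ->
  expR (n%:R * (d / 2 * (1 - d) + ln (s / d) / 2)) * gpot n (s / d + s) (fun _ => 0) <=
  expR (- (n%:R * (d ^+ 3 / 16))).
Proof.
move=> s0; rewrite gpot0 -expRD ler_expR -!mulrN -mulrDr; apply: ler_wpM2l => //.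
have dp : 0 < 1 + d by rewrite addr_gt0.
have -> : s / d + s = s / d * (1 + d) by field; rewrite gt_eqF.
have -> : ln (s / d * (1 + d)) = ln (s / d) + ln (1 + d) by rewrite lnM ?posrE ?divr_gt0.
have : ln (1 + d)^-1 <= (1 + d)^-1 - 1.
  by rewrite -{1}[(1 + d)^-1](subrK 1) addrC; apply: le_ln1Dx; rewrite ltrBrDl subrr invr_gt0.
rewrite lnV ?posrE// => h.
have e : (1 + d)^-1 - 1 = - d * (1 + d)^-1 by field; rewrite gt_eqF.
(* The linear bound on the logarithm leaves a rate of third order in [d]; the smaller [d ^+ 3 / 16]
   is shared with the noise tail. *)
have k : d / 2 * (1 - d) - d * (1 + d)^-1 / 2 = - (d ^+ 3 / 2 * (1 + d)^-1) by field; rewrite gt_eqF.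
have h2 : d ^+ 3 / 16 <= d ^+ 3 / 2 * (1 + d)^-1.
  rewrite -mulrA; apply: ler_wpM2l; first by rewrite exprn_ge0// ltW.
  have : (2 : R)^-1 <= (1 + d)^-1 by rewrite lef_pV2 ?posrE//; move: d1; lra.
  lra.
lra.
Qed.

Let mcode i : measurable_fun [set: CS * RS] (fun p => p.1 i).
Proof. exact: (measurableT_comp (measurable_coord i) measurable_fst). Qed.

Let mnoise : measurable_fun [set: CS * RS] (fun p => p.2).
Proof. exact: measurable_snd. Qed.

Let mnoiseless wa wb : measurable_fun [set: CS * RS] (fun p => noiseless p.1 wa wb : RS).
Proof. exact: measurable_affine_seq. Qed.

Let mreceived wa wb : measurable_fun [set: CS * RS] (fun p => received p wa wb : RS).
Proof. exact: measurable_addseq. Qed.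

Let mcleared wa wb : measurable_fun [set: CS * RS]
  (fun p => (fun t => sa * p.1 (ia wa) t - received p wa wb t) : RS).
Proof.
rewrite (_ : (fun p => _) = fun p : CS * RS => (fun t => sa * p.1 (ia wa) t + -1 * received p wa wb t) : RS).
  exact: measurable_affine_seq.
by apply/funext => p; apply/funext => t; rewrite mulN1r.
Qed.

Let mresidual wa wb wa' wb' : measurable_fun [set: CS * RS]
  (fun p => residual p.1 (received p wa wb) wa' wb' : RS).
Proof.
rewrite (_ : (fun p => _) = fun p : CS * RS => (fun t => (sa * p.1 (ia wa') t + -1 * received p wa wb t) + sb * p.1 (ib wb') t) : RS).
  apply: measurable_addseq; last exact: measurable_mulseq.
  exact: measurable_affine_seq.
by apply/funext => p; apply/funext => t; rewrite mulN1r.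
Qed.

Let mconfusion s (e : CS * RS -> R) wa wb wa' wb' : measurable_fun setT e ->
  measurable_fun [set: CS * RS] (fun p => confusion s p.1 (received p wa wb) (e p) wa' wb').
Proof.
move=> me; rewrite /confusion; apply: measurable_funM => //; apply: measurable_funM.
  exact: measurable_gpot.
by apply: measurableT_comp => //; apply: measurable_funM.
Qed.

Lemma mean_noise_tail : mean_le n N (fun p => noise_tail p.2) (expR (- (n%:R * (d ^+ 3 / 16)))).
Proof.
apply: mean_le_noise => [|p|c]; last exact: integral_noise_tail; last exact: expR_ge0.
rewrite /noise_tail; apply: measurableT_comp => //; apply: measurable_funM => //.
by apply: measurable_funB => //; exact: measurable_energy.
Qed.

(** A codeword that enters only through the kernel can be averaged out: resample it and apply the
    semigroup identity, which adds its power to the variance. *)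
Lemma integral_codebook_gpot i (v s : R) (w : CS -> RS) (k : CS -> R) :
  (i < N)%N -> 0 < v -> 0 <= s -> measurable_fun setT w -> measurable_fun setT k ->
  (forall c, 0 <= k c) -> (forall c x, w (upd c i x) = w c) -> (forall c x, k (upd c i x) = k c) ->
  (\int[codebook R n N]_c (k c * gpot n v (fun t => w c t + s * c i t))%:E =
   \int[codebook R n N]_c (k c * gpot n (v + s ^+ 2) (w c))%:E)%E.
Proof.
move=> iN v0 s0 mw mk k0 wi ki.
have mg : measurable_fun [set: CS] (fun c => gpot n v (fun t => w c t + s * c i t)).
  apply: measurable_gpot; apply: measurable_addseq => //.
  exact: (measurable_mulseq s (measurable_coord i)).
rewrite /codebook (integral_resample _ _ iN); last 2 first.
- by apply/measurable_EFinP; exact: measurable_funM.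
- by move=> c; rewrite lee_fin mulr_ge0 ?expR_ge0.
apply: eq_integral => c _; rewrite EFinM -(integral_gpot n (w c) v0 s0).
rewrite -ge0_integralZl; [|exact: measurableT| |by move=> z _; rewrite lee_fin expR_ge0|by rewrite lee_fin]; last first.
  apply/measurable_EFinP; apply: measurable_gpot.
  exact: (measurable_addseq (measurable_cst (w c)) (measurable_mulseq s (@measurable_id _ _ setT))).
by apply: eq_integral => x _; rewrite ki wi /upd eqxx EFinM.
Qed.

Lemma integral_low_tail s (w : nat -> R) : 0 < s ->
  (\int[giid R n]_z (low_tail s (fun t => w t + z t)%R)%:E =
   (expR (n%:R * (d / 2 * (1 - d) + ln (s / d) / 2)) * gpot n (s / d + 1 ^+ 2) w)%:E)%E.
Proof.
move=> s0; have v0 : 0 < s / d by exact: divr_gt0.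
rewrite EFinM -(integral_gpot n w v0 ler01).
rewrite -ge0_integralZl; [|exact: measurableT| |by move=> z _; rewrite lee_fin expR_ge0|by rewrite lee_fin expR_ge0]; last first.
  apply/measurable_EFinP; apply: measurable_gpot.
  exact: (measurable_addseq (measurable_cst (w : RS)) (measurable_mulseq 1 (@measurable_id _ _ setT))).
apply: eq_integral => z _; rewrite (low_tailE s0) -EFinM.
by rewrite (_ : (fun t => w t + 1 * z t) = fun t => w t + z t)//; apply/funext => t; rewrite mul1r.
Qed.

Let mlow_tail s d' (T : measurableType d') (f : T -> RS) : measurable_fun setT f ->
  measurable_fun setT (fun x => low_tail s (f x)).
Proof.
move=> mf; rewrite /low_tail; apply: measurableT_comp => //; apply: measurable_funM => //.
by apply: measurable_funB => //; exact: measurable_energy.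
Qed.

Lemma mean_low_tail1 wa wb :
  mean_le n N (fun p => low_tail s1 (fun t => sa * p.1 (ia wa) t - received p wa wb t))
    (expR (- (n%:R * (d ^+ 3 / 16)))).
Proof.
split=> [|p|]; [exact: mlow_tail|exact: expR_ge0|].
have E c z : low_tail s1 (fun t => sa * c (ia wa) t - received (c, z) wa wb t) =
    low_tail s1 (fun t => sb * c (ib wb) t + z t).
  rewrite /low_tail (@energyN n _ (fun t => sb * c (ib wb) t + z t))//.
  by move=> t; rewrite /received /noiseless/=; ring.
under eq_integral do under eq_integral do rewrite E/=.
under eq_integral do rewrite integral_low_tail//.
under eq_integral.
  move=> c _; rewrite (_ : (fun t => sb * c (ib wb) t) = (fun t => (fun=> 0) c t + sb * c (ib wb) t) :> (nat -> R)); last first.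
    by apply/funext => t; rewrite add0r.
  over.
have v0 : 0 < s1 / d + 1 ^+ 2 by rewrite addr_gt0// divr_gt0.
rewrite (@integral_codebook_gpot (ib wb) _ sb (fun _ => (fun _ => 0) : RS) (fun _ => expR _))//.
by rewrite integral_prob_cst lee_fin expr1n -addrA; exact: low_tail_rate.
Qed.

Lemma mean_low_tail2 wa wb :
  mean_le n N (fun p => low_tail s2 (received p wa wb)) (expR (- (n%:R * (d ^+ 3 / 16)))).
Proof.
split=> [|p|]; [exact: mlow_tail|exact: expR_ge0|].
under eq_integral.
  move=> c _; rewrite (integral_low_tail (noiseless c wa wb) s20).
  rewrite (_ : noiseless _ _ _ = fun t => (fun t => sa * c (ia wa) t) t + sb * c (ib wb) t); last first.
    by apply/funext => t; rewrite /noiseless addrC.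
  over.
have v0 : 0 < s2 / d + 1 ^+ 2 by rewrite addr_gt0// divr_gt0.
rewrite (@integral_codebook_gpot (ib wb) _ sb (fun c => (fun t => sa * c (ia wa) t) : RS) (fun _ => expR _))//; last 2 first.
- exact: (measurable_mulseq sa (measurable_coord (ia wa))).
- by move=> c x; rewrite /upd (negbTE (iab _ _)).
under eq_integral.
  move=> c _; rewrite (_ : (fun t => sa * c (ia wa) t) = (fun t => (fun=> 0) c t + sa * c (ia wa) t) :> (nat -> R)); last first.
    by apply/funext => t; rewrite add0r.
  over.
rewrite (@integral_codebook_gpot (ia wa) _ sa (fun _ => (fun _ => 0) : RS) (fun _ => expR _))//; last by rewrite ltr_wpDr ?sqr_ge0.
by rewrite integral_prob_cst lee_fin expr1n -!addrA (addrA 1); exact: low_tail_rate.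
Qed.

(** Once the wrong codewords are averaged out, the kernel has the variance [s] of the observation,
    and its exponential cancels [expR (e / (2 * s))]. The mean then no longer depends on the
    observation. *)
Lemma confusion_int s (w : nat -> R) : 0 < s ->
  expR (n%:R * d) * expR (energy n w / (2 * s)) * gpot n s w = expR (n%:R * (d - ln s / 2)).
Proof. by move=> s0; rewrite /gpot -!expRD; congr expR; field; lra. Qed.

Lemma mean_confusion1 wa wb wb' : wb' != wb ->
  mean_le n N (fun p => confusion s1 p.1 (received p wa wb)
      (energy n (fun t => sa * p.1 (ia wa) t - received p wa wb t)) wa wb')
    (expR (n%:R * (d - ln s1 / 2))).
Proof.
move=> wb'n.
have me : measurable_fun [set: CS * RS]
    (fun p => energy n (fun t => sa * p.1 (ia wa) t - received p wa wb t)).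
  exact: measurable_energy.
apply: mean_le_swap => [|p|z]; first exact: mconfusion.
  by rewrite /confusion /gpot -!expRD expR_ge0.
pose w (c : CS) : RS := fun t => sa * c (ia wa) t - received (c, z) wa wb t.
pose k c := expR (n%:R * d) * expR (energy n (w c) / (2 * s1)).
have mw : measurable_fun setT w by exact: (measurableT_comp (mcleared wa wb) (measurable_pair2 _)).
under eq_integral.
  move=> c _; rewrite (_ : confusion _ _ _ _ _ _ = k c * gpot n 1 (fun t => w c t + sb * c (ib wb') t)); last first.
    by rewrite /confusion /k mulrAC mulrA.
  over.
have wU c x : w (upd c (ib wb') x) = w c.
  rewrite /w /received /noiseless /upd/= (negbTE (iab _ _)).
  by rewrite (inj_eq ib_inj) eq_sym (negbTE wb'n).
rewrite (@integral_codebook_gpot (ib wb') 1 sb w k)//.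
- under eq_integral do rewrite confusion_int//.
  by rewrite integral_prob_cst.
- apply: measurable_funM => //; apply: measurableT_comp => //; apply: measurable_funM => //.
  exact: measurable_energy.
- by move=> c; rewrite /k -expRD expR_ge0.
- by move=> c x; rewrite /k wU.
Qed.

(** Neither wrong codeword occurs in the observation, so they are averaged out in turn, raising the
    variance from 1 to [1 + sb ^+ 2] and then to [s2]. *)
Lemma mean_confusion2 wa wb wa' wb' : wa' != wa -> wb' != wb ->
  mean_le n N (fun p => confusion s2 p.1 (received p wa wb)
      (energy n (received p wa wb)) wa' wb')
    (expR (n%:R * (d - ln s2 / 2))).
Proof.
move=> wa'n wb'n.
have me : measurable_fun [set: CS * RS] (fun p => energy n (received p wa wb)).
  exact: measurable_energy.
apply: mean_le_swap => [|p|z]; first exact: mconfusion.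
  by rewrite /confusion /gpot -!expRD expR_ge0.
pose y (c : CS) : RS := received (c, z) wa wb.
pose w (c : CS) : RS := fun t => sa * c (ia wa') t + -1 * y c t.
pose k c := expR (n%:R * d) * expR (energy n (y c) / (2 * s2)).
have my : measurable_fun setT y by exact: (measurableT_comp (mreceived wa wb) (measurable_pair2 _)).
have mw : measurable_fun setT w.
  by apply: measurable_affine_seq => //; exact: measurable_coord.
under eq_integral.
  move=> c _; rewrite (_ : confusion _ _ _ _ _ _ = k c * gpot n 1 (fun t => w c t + sb * c (ib wb') t)); last first.
    rewrite /confusion /k mulrAC mulrA (_ : residual _ _ _ _ = fun t => w c t + sb * c (ib wb') t)//.
    by apply/funext => t; rewrite /residual /w mulN1r.
  over.
have yU c x : y (upd c (ib wb') x) = y c.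
  rewrite /y /received /noiseless /upd/= (negbTE (iab _ _)).
  by rewrite (inj_eq ib_inj) eq_sym (negbTE wb'n).
have yU' c x : y (upd c (ia wa') x) = y c.
  rewrite /y /received /noiseless /upd/= [ib wb == _]eq_sym (negbTE (iab _ _)).
  by rewrite (inj_eq ia_inj) eq_sym (negbTE wa'n).
have mk : measurable_fun setT k.
  apply: measurable_funM => //; apply: measurableT_comp => //; apply: measurable_funM => //.
  exact: measurable_energy.
have k0 c : 0 <= k c by rewrite /k -expRD expR_ge0.
rewrite (@integral_codebook_gpot (ib wb') 1 sb w k)//; last 2 first.
- by move=> c x; rewrite /w yU /upd (negbTE (iab _ _)).
- by move=> c x; rewrite /k yU.
pose w' (c : CS) : RS := fun t => -1 * y c t.
under eq_integral.
  move=> c _; rewrite (_ : w c = (fun t => w' c t + sa * c (ia wa') t)); last first.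
    by apply/funext => t; rewrite /w /w' addrC.
  over.
rewrite (@integral_codebook_gpot (ia wa') _ sa w' k)//.
- under eq_integral.
    move=> c _; rewrite (@gpotN _ _ _ (w' c) (y c)); last by move=> t; rewrite /w' mulN1r.
    by rewrite /k confusion_int//; over.
  by rewrite integral_prob_cst.
- exact: measurable_mulseq.
- by move=> c x; rewrite /w' yU'.
- by move=> c x; rewrite /k yU'.
Qed.

Lemma mean_power_tail i : (i < N)%N ->
  mean_le n N (fun p => noise_tail (p.1 i)) (expR (- (n%:R * (d ^+ 3 / 16)))).
Proof.
move=> iN.
have mt (T : measurableType _) (f : T -> RS) : measurable_fun setT f ->
    measurable_fun setT (fun x => noise_tail (f x)).
  move=> mf; rewrite /noise_tail; apply: measurableT_comp => //; apply: measurable_funM => //.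
  by apply: measurable_funB => //; exact: measurable_energy.
split=> [|p|]; [exact: mt|exact: expR_ge0|].
under eq_integral.
  move=> c _; rewrite /= integral_prob_cst.
  over.
apply: (@integral_codebook_le _ _ _ i _ _ iN) => [|c|c].
- by apply/measurable_EFinP; apply: mt; exact: measurable_coord.
- by rewrite lee_fin expR_ge0.
- under eq_integral do rewrite /upd eqxx; exact: integral_noise_tail.
Qed.

(** The last two terms reach 1 when one of the sent codewords is too strong, the only case in which
    the transmitted signal departs from the codebook. *)
Definition decoding_bound (p : CS * RS) wa wb : R :=
  noise_tail p.2 + low_tail s1 (fun t => sa * p.1 (ia wa) t - received p wa wb t) +
  low_tail s2 (received p wa wb) +
  \sum_(wb' | wb' != wb) confusion s1 p.1 (received p wa wb)
      (energy n (fun t => sa * p.1 (ia wa) t - received p wa wb t)) wa wb' +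
  \sum_(wb' | wb' != wb) \sum_(wa' | wa' != wa) confusion s2 p.1 (received p wa wb)
      (energy n (received p wa wb)) wa' wb' +
  noise_tail (p.1 (ia wa)) + noise_tail (p.1 (ib wb)).

Let rho := expR (- (n%:R * (d ^+ 3 / 16))).

Lemma mean_decoding_bound wa wb : mean_le n N (fun p => decoding_bound p wa wb)
  (5 * rho + Mb.+1%:R * expR (n%:R * (d - ln s1 / 2)) +
   (Ma * Mb.+1)%:R * expR (n%:R * (d - ln s2 / 2))).
Proof.
have K1 := expR_ge0 (n%:R * (d - ln s1 / 2)).
have K2 := expR_ge0 (n%:R * (d - ln s2 / 2)).
have le_sum (I : finType) (P : pred I) (K : R) : 0 <= K -> \sum_(i | P i) K <= #|I|%:R * K.
  by move=> K0; rewrite sumr_const -[leLHS]mulr_natl; apply: ler_wpM2r => //; rewrite ler_nat max_card.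
have h1 : mean_le n N (fun p => \sum_(wb' | wb' != wb) confusion s1 p.1 (received p wa wb)
      (energy n (fun t => sa * p.1 (ia wa) t - received p wa wb t)) wa wb')
    (Mb.+1%:R * expR (n%:R * (d - ln s1 / 2))).
  apply: mean_leW (mean_le_sum (fun wb' => @mean_confusion1 wa wb wb')).
  by have := le_sum _ (fun wb' => wb' != wb) _ K1; rewrite card_ord.
have h2 : mean_le n N (fun p => \sum_(wb' | wb' != wb) \sum_(wa' | wa' != wa) confusion s2 p.1 (received p wa wb)
      (energy n (received p wa wb)) wa' wb')
    ((Ma * Mb.+1)%:R * expR (n%:R * (d - ln s2 / 2))).
  apply: mean_leW; last first.
    apply: (@mean_le_sum _ _ _ _ _ _ (\sum_(wa' | wa' != wa) expR (n%:R * (d - ln s2 / 2)))) => wb' wb'n.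
    by apply: mean_le_sum => wa' wa'n; exact: mean_confusion2.
  apply: le_trans (le_sum _ _ _ _) _; first exact: sumr_ge0.
  rewrite card_ord mulnC natrM -mulrA; apply: ler_wpM2l => //.
  by have := le_sum _ (fun wa' => wa' != wa) _ K2; rewrite card_ord.
have := mean_leD (mean_leD (mean_leD (mean_leD (mean_leD (mean_leD mean_noise_tail
  (mean_low_tail1 wa wb)) (mean_low_tail2 wa wb)) h1) h2)
  (mean_power_tail (iaN wa))) (mean_power_tail (ibN wb)).
by apply: mean_leW; rewrite -/rho; lra.
Qed.

Lemma decoding_bound_le c z wa wb (x : nat -> R) :
  (energy n (c (ia wa)) <= n%:R * (1 + d) -> energy n (c (ib wb)) <= n%:R * (1 + d) ->
    x = noiseless c wa wb) ->
  (threshold_decoder c (fun t => x t + z t) != wb)%:R <= decoding_bound (c, z) wa wb.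
Proof.
move=> xE; rewrite /decoding_bound.
have C0 s e a b : 0 <= confusion s c (received (c, z) wa wb) e a b.
  by rewrite /confusion /gpot -!expRD expR_ge0.
have T0 w : 0 <= noise_tail w by exact: expR_ge0.
set T := _ + _ + _ + _ + \sum_(_ | _) _.
have T_ge0 : 0 <= T.
  do ![apply: addr_ge0] => //; try exact: expR_ge0; first exact: sumr_ge0.
  by apply: sumr_ge0 => b _; exact: sumr_ge0.
have b1 (b : bool) : b%:R <= 1 :> R by case: b.
have viol w : n%:R * (1 + d) < energy n w -> 1 <= noise_tail w.
  move=> h; apply: le_trans (expR_ge1Dx _); rewrite lerDl mulr_ge0 ?subr_ge0 ?(ltW h)//.
  by rewrite divr_ge0// ltW.
have Ta := T0 (c (ia wa)); have Tb := T0 (c (ib wb)).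
have [ha|ha] := leP (energy n (c (ia wa))) (n%:R * (1 + d)); last first.
  by apply: le_trans (b1 _) _; move: (viol _ ha) => /=; lra.
have [hb|hb] := leP (energy n (c (ib wb))) (n%:R * (1 + d)); last first.
  by apply: le_trans (b1 _) _; move: (viol _ hb) => /=; lra.
rewrite (xE ha hb); have := decoding_error_le c z wa wb d0; rewrite -/T => h.
by apply: le_trans h _; move: Ta Tb => /=; lra.
Qed.

End receiver.

(** * The capacity region *)

Section achievability.
Context (R : realType).
Local Notation RS := (mseq (measurableTypeR R)).
Local Notation CS := (mseq RS).

(** Of the margin [2 * d], one [d] absorbs the factor in [confusion] and the other gives decay. The
    bound [B] is fixed before the codebook [c] and the signals [x], so bounds of several receivers
    can be added first. *)
Lemma exists_receiver_bound n N Ma Mb (sa sb d ra rb : R) (ia : 'I_Ma -> nat) (ib : 'I_Mb.+1 -> nat) :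
  0 <= sa -> 0 <= sb -> 0 < d -> d <= 1 / 2 -> injective ia -> injective ib ->
  (forall a b, ia a != ib b) -> (forall a, (ia a < N)%N) -> (forall b, (ib b < N)%N) ->
  (0 < Ma)%N -> Ma%:R <= 2 * expR (n%:R * ra) -> Mb.+1%:R <= 2 * expR (n%:R * rb) ->
  rb + 2 * d <= ln (1 + sb ^+ 2) / 2 -> ra + rb + 2 * d <= ln (1 + sb ^+ 2 + sa ^+ 2) / 2 ->
  exists2 B : CS * RS -> R, mean_le n N B (11 * expR (- (n%:R * (d ^+ 3 / 16)))) &
    forall (c : CS) (x : 'I_Ma -> 'I_Mb.+1 -> nat -> R),
    (forall a b, energy n (c (ia a)) <= n%:R * (1 + d) -> energy n (c (ib b)) <= n%:R * (1 + d) ->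
      x a b = noiseless sa sb ia ib c a b) ->
    ((\sum_a \sum_b perr n (threshold_decoder n sa sb d ia ib c) (x a b) b)%:E <=
      (Ma * Mb.+1)%:R%:E * \int[giid R n]_z (B (c, z))%:E)%E.
Proof.
move=> sa0 sb0 d0 d1 ia_inj ib_inj iab iaN ibN Ma0 Mra Mrb h1 h2.
set rho := expR _.
have rho_small : expR (- (n%:R * d)) <= rho.
  rewrite ler_expR lerN2; apply: ler_wpM2l => //.
  by have : d ^+ 2 <= 1; [rewrite expr_le1 ?(ltW d0)//; lra|rewrite exprS; nra].
have MM0 : 0 < (Ma * Mb.+1)%:R :> R by rewrite ltr0n muln_gt0 Ma0.
have K1 : Mb.+1%:R * expR (n%:R * (d - ln (1 + sb ^+ 2) / 2)) <= 2 * rho.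
  apply: (@le_trans _ _ (2 * expR (n%:R * rb) * expR (n%:R * (d - ln (1 + sb ^+ 2) / 2)))).
    by apply: ler_wpM2r => //; exact: expR_ge0.
  rewrite -mulrA ler_pM2l// -expRD; apply: le_trans rho_small.
  rewrite ler_expR -mulrDr -[leRHS]mulrN; apply: ler_wpM2l => //; lra.
have K2 : (Ma * Mb.+1)%:R * expR (n%:R * (d - ln (1 + sb ^+ 2 + sa ^+ 2) / 2)) <= 4 * rho.
  apply: (@le_trans _ _ (2 * expR (n%:R * ra) * (2 * expR (n%:R * rb)) *
      expR (n%:R * (d - ln (1 + sb ^+ 2 + sa ^+ 2) / 2)))).
    by apply: ler_wpM2r; [exact: expR_ge0|rewrite natrM; apply: ler_pM].
  rewrite mulrACA (_ : 2 * 2 = 4); last by ring.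
  rewrite -mulrA ler_pM2l// -!expRD; apply: le_trans rho_small.
  rewrite ler_expR -!mulrDr -[leRHS]mulrN; apply: ler_wpM2l => //; lra.
pose W a b (p : CS * RS) := decoding_bound n sa sb d ia ib p a b.
(* Here [11 = 5 + 2 + 4]: five tails, and the message counts exceed their exponentials by factors of
   at most 2 and [2 * 2]. *)
have mW a b : mean_le n N (W a b) (11 * rho).
  apply: mean_leW (mean_decoding_bound n sa0 sb0 d0 d1 ia_inj ib_inj iab iaN ibN a b).
  rewrite -/rho; lra.
exists (fun p => (Ma * Mb.+1)%:R^-1 * \sum_a \sum_b W a b p).
  have := mean_le_sum (fun a (_ : xpredT a) => mean_le_sum (fun b (_ : xpredT b) => mW a b)).
  move=> /(mean_le_scale (_ : 0 <= (Ma * Mb.+1)%:R^-1)) H.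
  apply: mean_leW (H _); last by rewrite invr_ge0.
  by rewrite !sumr_const !card_ord -mulrnA -[X in _ * X]mulr_natl [(Mb.+1 * Ma)%N]mulnC mulKf// gt_eqF.
move=> c x xE.
have mT : decoder n (threshold_decoder n sa sb d ia ib c).
  by apply: borel_n_decoder => w; exact: threshold_decoder_borel.
have m1 a b : measurable_fun setT (fun z : RS => (W a b (c, z))%:E).
  case: (mW a b) => mWab _ _; apply/measurable_EFinP.
  exact: measurableT_comp mWab (measurable_pair1 _).
have W0 a b z : (0 <= (W a b (c, z))%:E)%E by case: (mW a b) => _ W0 _; rewrite lee_fin.
under eq_integral do rewrite EFinM -sumEFin.
rewrite ge0_integralZl//; last 2 first.
- apply: emeasurable_sum => a; under eq_fun do rewrite -sumEFin; exact: emeasurable_sum.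
- by move=> z _; apply: sume_ge0 => a _; rewrite -sumEFin; exact: sume_ge0.
rewrite muleA -EFinM mulfV ?gt_eqF// mul1e ge0_integral_sum//; last 2 first.
- by move=> a; under eq_fun do rewrite -sumEFin; exact: emeasurable_sum.
- by move=> a z _; rewrite -sumEFin; exact: sume_ge0.
rewrite -sumEFin; apply: lee_sum => a _.
under eq_integral do rewrite -sumEFin.
rewrite ge0_integral_sum//.
rewrite -sumEFin; apply: lee_sum => b _.
rewrite perrK//; apply: ge0_le_integral => //; first exact: mberr mT.
by move=> z _; rewrite lee_fin; apply: decoding_bound_le => //; exact: xE.
Qed.

(** Dividing the power by [1 + d] divides [1 + S] by at most [1 + d]. *)
Lemma ln_backoff (S d : R) : 0 < S -> 0 < d -> ln (1 + S) - d <= ln (1 + S / (1 + d)).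
Proof.
move=> S0 d0; have dp : 0 < 1 + d by rewrite addr_gt0.
have Sd : 0 < S / (1 + d) by rewrite divr_gt0.
have h : 1 + S <= (1 + S / (1 + d)) * (1 + d).
  by rewrite mulrDl mul1r divfK ?gt_eqF//; lra.
have : ln (1 + S) <= ln ((1 + S / (1 + d)) * (1 + d)).
  by rewrite ler_ln ?posrE// ?mulr_gt0// addr_gt0.
rewrite lnM ?posrE//; last by rewrite addr_gt0.
have : ln (1 + d) <= d by apply: le_ln1Dx; lra.
lra.
Qed.

Lemma exists_size (y : R) : 0 <= y -> exists m : nat, expR y <= m.+1%:R <= 2 * expR y.
Proof.
move=> y0; have h : 1 <= expR y by have := expR_ge1Dx y; lra.
exists (Num.truncn (expR y)).
have /andP[h1 h2] := truncn_itv (expR_ge0 y).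
by rewrite ltW//= -natr1; lra.
Qed.

(* Codeword w of user k is the entry 4 w + k of the random codebook; user 0 is the dummy interferer
   of receiver 1. *)
Definition slot k M (w : 'I_M) : nat := (4 * w + k)%N.

Lemma slot_inj k M : injective (@slot k M).
Proof. by move=> w w'; rewrite /slot => h; apply: ord_inj; lia. Qed.

Lemma slot_neq k l M M' (w : 'I_M) (w' : 'I_M') : (k < 4)%N -> (l < 4)%N -> k != l ->
  slot k w != slot l w'.
Proof. by rewrite /slot => k4 l4 /eqP kl; apply/eqP => h; apply: kl; lia. Qed.

Lemma slot_lt k M (w : 'I_M) N : (k < 4)%N -> (M <= N)%N -> (slot k w < 4 * N)%N.
Proof. by rewrite /slot => k4 MN; have := ltn_ord w; lia. Qed.

Lemma achievable_strict (a1 a2 P1 P2 P3 r1 r2 r3 : R) :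
  0 < P1 -> 0 < P2 -> 0 < P3 -> 0 < a1 -> 0 < a2 -> 0 <= r1 -> 0 <= r2 -> 0 <= r3 ->
  r1 < Cg P1 -> r2 < Cg P2 -> r3 < Cg P3 ->
  r1 + r2 < Cg (a1 ^+ 2 * P1 + P2) -> r2 + r3 < Cg (a2 ^+ 2 * P2 + P3) ->
  achievable a1 a2 P1 P2 P3 (r1, r2, r3).
Proof.
move=> P10 P20 P30 a10 a20 r10 r20 r30.
have ltCg (r x : R) : (r < Cg x) = (r * ln 2 < ln (1 + x) / 2).
  by rewrite /Cg invfM mulrA ltr_pdivlMr// ln_gt0 ?ltr1n.
rewrite !ltCg => g1 g2 g3 g12 g23.
split=> // e e0.
(* A third of the least of the five rate gaps and 1. Each receiver uses [2 * d]; the last [d] covers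
   the power back-off. *)
have [d [d0 d12 [d1 d2 d3 d4 d5]]] : exists d : R, [/\ 0 < d, d <= 1 / 2 &
    [/\ r1 * ln 2 + 3 * d <= ln (1 + P1) / 2, r2 * ln 2 + 3 * d <= ln (1 + P2) / 2,
     r3 * ln 2 + 3 * d <= ln (1 + P3) / 2,
     (r1 + r2) * ln 2 + 3 * d <= ln (1 + (a1 ^+ 2 * P1 + P2)) / 2 &
     (r2 + r3) * ln 2 + 3 * d <= ln (1 + (a2 ^+ 2 * P2 + P3)) / 2]].
  have mn (x y : R) : 0 < x -> 0 < y -> exists z : R, [/\ 0 < z, z <= x & z <= y].
    by move=> x0 y0; exists (Num.min x y); rewrite lt_min x0 y0 !ge_min !lexx orbT.
  rewrite -subr_gt0 in g1; rewrite -subr_gt0 in g2; rewrite -subr_gt0 in g3.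
  rewrite -subr_gt0 in g12; rewrite -subr_gt0 in g23.
  have [z1 [z10 z11 z12]] := mn _ _ g1 g2.
  have [z2 [z20 z21 z22]] := mn _ _ g3 g12.
  have [z3 [z30 z31 z32]] := mn _ _ z10 z20.
  have [z4 [z40 z41 z42]] := mn _ _ z30 g23.
  have [z5 [z50 z51 z52]] := mn _ _ z40 (ltr01 : (0 : R) < 1).
  by exists (z5 / 3); split; [lra|lra|split; lra].
(* Three receivers contribute [33 * rho] on average; 34 makes the selection of a codebook strict. *)
have [N0 HN0] := @expR_small R (d ^+ 3 / 16) (e / 34) ltac:(by rewrite divr_gt0// exprn_gt0) ltac:(lra).
exists N0 => n /HN0; set rho := expR _ => rhoe.
have l2 : 0 < ln 2 :> R by rewrite ln_gt0 ?ltr1n.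
have sz (r : R) : 0 <= r -> 0 <= n%:R * (r * ln 2) by move=> r0; apply: mulr_ge0 => //; apply: mulr_ge0 => //; exact: ltW.
have [m1 /andP[m1l m1u]] := exists_size (sz _ r10).
have [m2 /andP[m2l m2u]] := exists_size (sz _ r20).
have [m3 /andP[m3l m3u]] := exists_size (sz _ r30).
pose N := (m1 + m2 + m3).+1.
pose sg (P : R) := Num.sqrt (P / (1 + d)).
have dp : 0 < 1 + d by rewrite addr_gt0.
have sg0 (P : R) : 0 <= sg P by exact: sqrtr_ge0.
have sg2 (P : R) : 0 < P -> sg P ^+ 2 = P / (1 + d).
  by move=> P0; rewrite sqr_sqrtr// divr_ge0 ?ltW.
have N1 : (m1.+1 <= N)%N by rewrite ltnS -addnA leq_addr.
have N2 : (m2.+1 <= N)%N by rewrite ltnS addnAC leq_addl.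
have N3 : (m3.+1 <= N)%N by rewrite ltnS leq_addl.
have backoff (r S : R) : 0 < S -> r + 3 * d <= ln (1 + S) / 2 -> r + 2 * d <= ln (1 + S / (1 + d)) / 2.
  by move=> S0 h; have := ln_backoff S0 d0; lra.
have [B1 meanB1 errB1] : exists2 B : CS * RS -> R, mean_le n (4 * N) B (11 * rho) &
    forall (c : CS) (x : 'I_1 -> 'I_m1.+1 -> nat -> R),
    (forall a b, energy n (c (slot 0 a)) <= n%:R * (1 + d) -> energy n (c (slot 1 b)) <= n%:R * (1 + d) ->
      x a b = noiseless 0 (sg P1) (@slot 0 1) (@slot 1 m1.+1) c a b) ->
    ((\sum_a \sum_b perr n (threshold_decoder n 0 (sg P1) d (@slot 0 1) (@slot 1 m1.+1) c) (x a b) b)%:E <=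
      (1 * m1.+1)%:R%:E * \int[giid R n]_z (B (c, z))%:E)%E.
  apply: (@exists_receiver_bound n (4 * N) 1 m1 0 (sg P1) d 0 (r1 * ln 2)) => //; try exact: slot_inj.
  - by move=> a b; exact: slot_neq.
  - by move=> a; exact: slot_lt.
  - by move=> b; exact: slot_lt.
  - by rewrite mulr0 expR0; lra.
  - by rewrite sg2//; exact: backoff.
  - by rewrite expr0n/= addr0 add0r sg2//; exact: backoff.
have [B2 meanB2 errB2] : exists2 B : CS * RS -> R, mean_le n (4 * N) B (11 * rho) &
    forall (c : CS) (x : 'I_m1.+1 -> 'I_m2.+1 -> nat -> R),
    (forall a b, energy n (c (slot 1 a)) <= n%:R * (1 + d) -> energy n (c (slot 2 b)) <= n%:R * (1 + d) ->
      x a b = noiseless (a1 * sg P1) (sg P2) (@slot 1 m1.+1) (@slot 2 m2.+1) c a b) ->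
    ((\sum_a \sum_b perr n (threshold_decoder n (a1 * sg P1) (sg P2) d (@slot 1 m1.+1) (@slot 2 m2.+1) c) (x a b) b)%:E <=
      (m1.+1 * m2.+1)%:R%:E * \int[giid R n]_z (B (c, z))%:E)%E.
  apply: (@exists_receiver_bound n (4 * N) m1.+1 m2 (a1 * sg P1) (sg P2) d (r1 * ln 2) (r2 * ln 2)) => //; try exact: slot_inj.
  - by rewrite mulr_ge0// ltW.
  - by move=> a b; exact: slot_neq.
  - by move=> a; exact: slot_lt.
  - by move=> b; exact: slot_lt.
  - by rewrite sg2//; exact: backoff.
  - rewrite exprMn !sg2// -[r1 * ln 2 + _]mulrDl
      (_ : 1 + _ + _ = 1 + (a1 ^+ 2 * P1 + P2) / (1 + d)); last by field; lra.
    apply: backoff => //.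
    by rewrite addr_gt0// mulr_gt0// exprn_gt0.
have [B3 meanB3 errB3] : exists2 B : CS * RS -> R, mean_le n (4 * N) B (11 * rho) &
    forall (c : CS) (x : 'I_m2.+1 -> 'I_m3.+1 -> nat -> R),
    (forall a b, energy n (c (slot 2 a)) <= n%:R * (1 + d) -> energy n (c (slot 3 b)) <= n%:R * (1 + d) ->
      x a b = noiseless (a2 * sg P2) (sg P3) (@slot 2 m2.+1) (@slot 3 m3.+1) c a b) ->
    ((\sum_a \sum_b perr n (threshold_decoder n (a2 * sg P2) (sg P3) d (@slot 2 m2.+1) (@slot 3 m3.+1) c) (x a b) b)%:E <=
      (m2.+1 * m3.+1)%:R%:E * \int[giid R n]_z (B (c, z))%:E)%E.
  apply: (@exists_receiver_bound n (4 * N) m2.+1 m3 (a2 * sg P2) (sg P3) d (r2 * ln 2) (r3 * ln 2)) => //; try exact: slot_inj.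
  - by rewrite mulr_ge0// ltW.
  - by move=> a b; exact: slot_neq.
  - by move=> a; exact: slot_lt.
  - by move=> b; exact: slot_lt.
  - by rewrite sg2//; exact: backoff.
  - rewrite exprMn !sg2// -[r2 * ln 2 + _]mulrDl
      (_ : 1 + _ + _ = 1 + (a2 ^+ 2 * P2 + P3) / (1 + d)); last by field; lra.
    apply: backoff => //.
    by rewrite addr_gt0// mulr_gt0// exprn_gt0.
have rho0 : 0 < rho by exact: expR_gt0.
have [c cB] := mean_le_exists (mean_leD (mean_leD meanB1 meanB2) meanB3)
  (ltac:(lra) : 11 * rho + 11 * rho + 11 * rho < 34 * rho).
have intB (B : CS * RS -> R) K : mean_le n (4 * N) B K ->
    (forall z, B (c, z) <= B1 (c, z) + B2 (c, z) + B3 (c, z)) ->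
    (\int[giid R n]_z (B (c, z))%:E <= e%:E)%E.
  move=> [mB B0 _] BB; apply: (@le_trans _ _ (34 * rho)%:E); last by rewrite lee_fin; lra.
  apply: le_trans (ltW cB); apply: ge0_le_integral => //.
  - by move=> z _; rewrite lee_fin.
  - by apply/measurable_EFinP; exact: measurableT_comp mB (measurable_pair1 _).
  - case: (mean_leD (mean_leD meanB1 meanB2) meanB3) => mBB _ _.
    by apply/measurable_EFinP; exact: measurableT_comp mBB (measurable_pair1 _).
  - by move=> z _; rewrite lee_fin.
have B10 z : 0 <= B1 (c, z) by case: meanB1.
have B20 z : 0 <= B2 (c, z) by case: meanB2.
have B30 z : 0 <= B3 (c, z) by case: meanB3.
(* Kept codewords have energy at most [n * (1 + d)] and are scaled by the root of [P / (1 + d)], so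
   the power constraint holds for each of them; the others become zero. *)
pose enc k P M (w : 'I_M) : nat -> R :=
  if energy n (c (slot k w)) <= n%:R * (1 + d) then (fun t => sg P * c (slot k w) t) else (fun _ => 0).
have encE k P M (w : 'I_M) : energy n (c (slot k w)) <= n%:R * (1 + d) ->
    enc k P M w = (fun t => sg P * c (slot k w) t) by rewrite /enc => ->.
have encP k P M (w : 'I_M) : 0 < P -> \sum_(t < n) (enc k P M w t) ^+ 2 <= n%:R * P.
  move=> P0; rewrite /enc; case: ifPn => [h|_]; last first.
    by rewrite big1 ?mulr_ge0 ?(ltW P0)// => t _; rewrite expr0n.
  under eq_bigr do rewrite exprMn sg2//.
  rewrite -mulr_sumr mulrAC ler_pdivrMr// mulrC [leRHS]mulrAC.
  by apply: ler_wpM2r => //; exact: ltW.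
pose dec1' := threshold_decoder n 0 (sg P1) d (@slot 0 1) (@slot 1 m1.+1) c.
pose dec2' := threshold_decoder n (a1 * sg P1) (sg P2) d (@slot 1 m1.+1) (@slot 2 m2.+1) c.
pose dec3' := threshold_decoder n (a2 * sg P2) (sg P3) d (@slot 2 m2.+1) (@slot 3 m3.+1) c.
exists m1.+1, m2.+1, m3.+1, (Code n (enc 1%N P1 m1.+1) (enc 2%N P2 m2.+1) (enc 3%N P3 m3.+1) dec1' dec2' dec3').
have okc : code_ok P1 P2 P3 (Code n (enc 1%N P1 m1.+1) (enc 2%N P2 m2.+1) (enc 3%N P3 m3.+1) dec1' dec2' dec3').
  split=> /=; try by move=> w; exact: encP.
  by split=> w; exact: threshold_decoder_borel.
rewrite !powR2E -!mulrA; split=> //.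
split.
- rewrite (err1E okc) -lee_fin EFinM/=.
  have := errB1 c (fun _ b => enc 1%N P1 m1.+1 b); rewrite big_ord1 mul1n => H.
  apply: le_trans (H _) _.
    by move=> a b _ h; rewrite encE//; apply/funext => t; rewrite /noiseless mul0r addr0.
  by apply: lee_wpmul2l; [rewrite lee_fin|apply: (intB _ _ meanB1) => z; rewrite -addrA lerDl addr_ge0].
- rewrite (err2E _ okc) -lee_fin EFinM/=.
  have H := errB2 c (fun a b t => enc 2%N P2 m2.+1 b t + a1 * enc 1%N P1 m1.+1 a t).
  apply: le_trans (H _) _.
    by move=> a b ha hb; rewrite !encE//; apply/funext => t; rewrite /noiseless mulrA.
  by apply: lee_wpmul2l; [rewrite lee_fin|apply: (intB _ _ meanB2) => z; rewrite addrAC lerDr addr_ge0].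
- rewrite (err3E _ okc) -lee_fin EFinM/=.
  have H := errB3 c (fun a b t => enc 3%N P3 m3.+1 b t + a2 * enc 2%N P2 m2.+1 a t).
  apply: le_trans (H _) _.
    by move=> a b ha hb; rewrite !encE//; apply/funext => t; rewrite /noiseless mulrA.
  by apply: lee_wpmul2l; [rewrite lee_fin|apply: (intB _ _ meanB3) => z; rewrite lerDr addr_ge0].
Qed.

End achievability.

(** * Passage to the closure *)

Lemma closure_tripleP (R : realType) (A : set (R * R * R)) (r1 r2 r3 : R) :
  closure A (r1, r2, r3) <-> forall e, 0 < e -> exists s1 s2 s3,
    [/\ A (s1, s2, s3), `|r1 - s1| < e, `|r2 - s2| < e & `|r3 - s3| < e].
Proof.
split=> [cA e e0|H B].
  have [[[s1 s2] s3] [As [[h1 h2] h3]]] := cA _ (nbhsx_ballx ((r1, r2), r3) e e0).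
  by exists s1, s2, s3; split.
move=> /nbhs_ballP[e /= e0 eB]; have [s1 [s2 [s3 [As h1 h2 h3]]]] := H e e0.
exists (s1, s2, s3); split=> //; apply: eB; by split; [split|].
Qed.

Lemma ler_Cg (R : realType) (x y : R) : 0 <= x -> x <= y -> Cg x <= Cg y.
Proof.
move=> x0 xy; rewrite /Cg ler_pM2r; last by rewrite invr_gt0 mulr_gt0// ln_gt0 ?ltr1n.
by rewrite ler_ln ?posrE ?lerD2l// ltr_wpDr// (le_trans x0).
Qed.

Lemma Cg_gt0 (R : realType) (x : R) : 0 < x -> 0 < Cg x.
Proof. by move=> x0; rewrite /Cg divr_gt0 ?mulr_gt0 ?ln_gt0 ?ltr1n ?ltrDl. Qed.

Theorem theorem2 (R : realType) (P1 P2 P3 a1 a2 : R) :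
  0 < P1 -> 0 < P2 -> 0 < P3 ->
  1 <= a1 -> a1 < Num.sqrt (1 + P2) ->
  1 <= a2 -> a2 < Num.sqrt (1 + P3) ->
  capacity_region a1 a2 P1 P2 P3 =
  [set r : R * R * R | let: (R1, R2, R3) := r in
     [/\ [/\ 0 <= R1, 0 <= R2 & 0 <= R3],
         [/\ R1 <= Cg P1, R2 <= Cg P2 & R3 <= Cg P3],
         [/\ R1 <= Cg (a1 ^+ 2 * P1) & R2 <= Cg (a2 ^+ 2 * P2)] &
         [/\ R1 + R2 <= Cg (a1 ^+ 2 * P1 + P2) &
             R2 + R3 <= Cg (a2 ^+ 2 * P2 + P3)]]].
Proof.
move=> P10 P20 P30 a11 _ a21 _.
have a10 : 0 < a1 by exact: lt_le_trans a11.
have a20 : 0 < a2 by exact: lt_le_trans a21.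
apply/seteqP; split=> [[[R1 R2] R3] /closure_tripleP H | [[R1 R2] R3]].
  (* Every bound of the region is a linear form of Lipschitz constant 1 for the sum of coordinate
     distances, hence survives limits of achievable triples. *)
  have lip_le (L : R -> R -> R -> R) (K : R) :
      (forall x y z x' y' z', L x y z - L x' y' z' <= `|x - x'| + `|y - y'| + `|z - z'|) ->
      (forall x y z, achievable a1 a2 P1 P2 P3 (x, y, z) -> L x y z <= K) -> L R1 R2 R3 <= K.
    move=> Llip LK; apply/ler_addgt0Pr => e e0.
    have [s1 [s2 [s3 [As h1 h2 h3]]]] := H (e / 3) ltac:(by rewrite divr_gt0).
    by have := LK _ _ _ As; have := Llip R1 R2 R3 s1 s2 s3; lra.
  have bnd x y z := @achievable_bounds R a1 a2 P1 P2 P3 x y z P10 P20 P30 a11 a21.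
  have abs_ge0 (x : R) := normr_ge0 x; have le_abs (x : R) := ler_norm x.
  have le_distC (x y : R) : y - x <= `|x - y| by rewrite distrC ler_norm.
  have R1P : R1 <= Cg P1.
    apply: (lip_le (fun x _ _ => x)) => [x y z x' y' z'|x y z /bnd[]//].
    by have := le_abs (x - x'); have := abs_ge0 (y - y'); have := abs_ge0 (z - z'); lra.
  have R2P : R2 <= Cg P2.
    apply: (lip_le (fun _ y _ => y)) => [x y z x' y' z'|x y z /bnd[]//].
    by have := le_abs (y - y'); have := abs_ge0 (x - x'); have := abs_ge0 (z - z'); lra.
  have sq_le (a P : R) : 1 <= a -> 0 < P -> P <= a ^+ 2 * P.
    by move=> a_ge1 P_gt0; rewrite ler_peMl ?(ltW P_gt0)// expr_ge1// (le_trans ler01).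
  split; split => //.
  - rewrite -oppr_le0; apply: (lip_le (fun x _ _ => - x)) => [x y z x' y' z'|x y z [? _ _ _]]; last by rewrite oppr_le0.
    by have := le_distC x x'; have := abs_ge0 (y - y'); have := abs_ge0 (z - z'); lra.
  - rewrite -oppr_le0; apply: (lip_le (fun _ y _ => - y)) => [x y z x' y' z'|x y z [_ ? _ _]]; last by rewrite oppr_le0.
    by have := le_distC y y'; have := abs_ge0 (x - x'); have := abs_ge0 (z - z'); lra.
  - rewrite -oppr_le0; apply: (lip_le (fun _ _ z => - z)) => [x y z x' y' z'|x y z [_ _ ? _]]; last by rewrite oppr_le0.
    by have := le_distC z z'; have := abs_ge0 (x - x'); have := abs_ge0 (y - y'); lra.
  - apply: (lip_le (fun _ _ z => z)) => [x y z x' y' z'|x y z /bnd[]//].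
    by have := le_abs (z - z'); have := abs_ge0 (x - x'); have := abs_ge0 (y - y'); lra.
  - by apply: le_trans R1P _; apply: ler_Cg; [exact: ltW|exact: sq_le].
  - by apply: le_trans R2P _; apply: ler_Cg; [exact: ltW|exact: sq_le].
  - apply: (lip_le (fun x y _ => x + y)) => [x y z x' y' z'|x y z /bnd[]//].
    by have := le_abs (x - x'); have := le_abs (y - y'); have := abs_ge0 (z - z'); lra.
  - apply: (lip_le (fun _ y z => y + z)) => [x y z x' y' z'|x y z /bnd[]//].
    by have := le_abs (y - y'); have := le_abs (z - z'); have := abs_ge0 (x - x'); lra.
move=> [[R10 R20 R30] [R1P R2P R3P] _ [R12 R23]]; apply/closure_tripleP => e e0.
(* Shrinking the triple by [1 - h] makes all bounds strict, their right-hand sides being positive.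
   As [q] exceeds [e], [h < 1]; as it exceeds each rate, a coordinate moves by less than
   [h * q = e]. *)
pose q : R := e + 1 + R1 + R2 + R3; pose h : R := e / q.
have q0 : 0 < q by rewrite /q; lra.
have h0 : 0 < h by rewrite divr_gt0.
have h1 : h < 1 by rewrite ltr_pdivrMr// mul1r /q; lra.
have close (x : R) : 0 <= x -> x < q -> `|x - (1 - h) * x| < e.
  move=> x0 xq; rewrite (_ : x - _ = h * x); last by ring.
  have hq : h * q = e by rewrite /h divfK ?gt_eqF.
  have hx : 0 <= h * x by apply: mulr_ge0 => //; exact: ltW.
  by rewrite (ger0_norm hx) -hq ltr_pM2l.
have shrink (x K : R) : 0 < K -> x <= K -> (1 - h) * x < K.
  move=> K0 xK; apply: (@le_lt_trans _ _ ((1 - h) * K)).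
    by apply: ler_wpM2l => //; lra.
  by rewrite gtr_pMl//; lra.
have sq_gt0 (a P Q : R) : 0 < a -> 0 < P -> 0 < Q -> 0 < a ^+ 2 * P + Q.
  by move=> *; rewrite addr_gt0// mulr_gt0// exprn_gt0.
exists ((1 - h) * R1), ((1 - h) * R2), ((1 - h) * R3).
split; [|by apply: close => //; rewrite /q; lra..].
apply: achievable_strict => //; rewrite -?mulrDr;
  by [rewrite mulr_ge0//; lra | apply: shrink => //; apply: Cg_gt0 => //; exact: sq_gt0].
Qed.
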